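(* Let $\Bbbk$ be any field and let $\Gamma=\Gamma_1\times\dots\times\Gamma_m$ be a finite-dimensional semi-simple $\Bbbk$-algebra with $\Gamma_j=M_{r_j}(F_j)$ for $1\le j\le m$, where $F_j$ is a division algebra over $\Bbbk$ and $r_j\in\mathbb{N}$; division algebras $F_i,F_j$ which are isomorphic over $\Bbbk$ are taken to be equal. Let $\phi:\Lambda\hookrightarrow\Gamma$ be a nodal embedding of a basic semi-simple $\Bbbk$-algebra $\Lambda$. Then, after identifying $\Lambda$ via a suitable $\Bbbk$-algebra isomorphism with a product of division algebras, $\phi$ is similar to a product (with respect to a suitable grouping of the factors of $\Gamma$ and of $\Lambda$) of the following ''elementary'' nodal embeddings: (1) $F\xrightarrow{\mathrm{id}}F$, where $F$ is a finite-dimensional division algebra over $\Bbbk$; (2) $F\to F\times F$, $a\mapsto(a,\tau(a))$, where $F$ is a finite-dimensional division $\Bbbk$-algebra and $\tau\in\mathrm{Aut}_\Bbbk(F)$ is an automorphism, which matters only through its class modulo inner automorphisms (the trivial class being allowed); (3) a homomorphism of $\Bbbk$-algebras $\imath:K\to L$, where $K$ and $L$ are finite-dimensional division $\Bbbk$-algebras with $\dim_\Bbbk(L)=2\dim_\Bbbk(K)$; (4) the canonical embedding $F\times F\to M_2(F)$, $(a,b)\mapsto\begin{pmatrix}a&0\\0&b\end{pmatrix}$, where $F$ is a finite-dimensional division $\Bbbk$-algebra; (5) the regular embedding $L\to M_2(K)$ associated with an extension $\imath:K\to L$, where $K$ and $L$ are finite-dimensional division $\Bbbk$-algebras with $\d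im_\Bbbk(L)=2\dim_\Bbbk(K)$.
   Context: Algebras and homomorphisms are unital. A semi-simple algebra is basic if it is a product of division algebras. An injective homomorphism $\phi:\Lambda\to\Gamma$ of finite-dimensional semi-simple $\Bbbk$-algebras is a nodal embedding if, viewing $\Gamma$ as a right $\Lambda$-module via $\phi$, the left $\Lambda$-module $\Gamma\otimes_\Lambda U$ has length at most $2$ for every simple left $\Lambda$-module $U$. Two homomorphisms $\phi,\widetilde\phi:\Lambda\to\Gamma$ of $\Bbbk$-algebras are similar if there is an invertible $b\in\Gamma$ with $\widetilde\phi(a)=b\phi(a)b^{-1}$ for all $a\in\Lambda$. Regular embedding: let $\imath:K\to L$ be a homomorphism of finite-dimensional division $\Bbbk$-algebras, regard $L$ as a right $K$-vector space $L_K$ via $\imath$, let $n=\dim_\Bbbk(L)/\dim_\Bbbk(K)$ be its dimension and $\mathfrak B$ a basis of $L_K$. The regular embedding $L\to M_n(K)$ sends $a\in L$ to the matrix in the basis $\mathfrak B$ of the right $K$-linear map $L\to L$, $x\mapsto ax$. Up to similarity it does not depend on $\mathfrak B$. *)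

(* Defs.v *)
From HB Require Import structures.
From mathcomp Require Import all_boot all_order all_algebra all_field.

Set Implicit Arguments.
Unset Strict Implicit.
Unset Printing Implicit Defensive.

Import GRing.Theory.
Local Open Scope ring_scope.

(* The matrix algebra M_n(F) over k, for n > 0 ('M[F]_n.-1.+1 is 'M[F]_n when *)
(* n is a successor, and is always a nonzero ring).  MathComp equips 'M[F]_n  *)
(* with the scalars F; here the scalars are k, acting entrywise.              *)
Definition matalg (k : fieldType) (F : algType k) (n : nat) : Type :=
  'M[F]_n.-1.+1.

Section MatrixAlgebra.
Variables (k : fieldType) (F : algType k) (n : nat).

HB.instance Definition _ := GRing.NzRing.copy (matalg F n) 'M[F]_n.-1.+1.

Definition matalg_scale (c : k) (M : matalg F n) : matalg F n :=
  map_mx (fun x : F => c *: x) M.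

Fact matalg_scaleA a b M :
  matalg_scale a (matalg_scale b M) = matalg_scale (a * b) M.
Proof. by apply/matrixP=> i j; rewrite !mxE scalerA. Qed.

Fact matalg_scale1 : left_id 1 matalg_scale.
Proof. by move=> M; apply/matrixP=> i j; rewrite !mxE scale1r. Qed.

Fact matalg_scaleDr : right_distributive matalg_scale +%R.
Proof. by move=> c M N; apply/matrixP=> i j; rewrite !mxE scalerDr. Qed.

Fact matalg_scaleDl M : {morph matalg_scale^~ M : a b / a + b}.
Proof. by move=> a b; apply/matrixP=> i j; rewrite !mxE scalerDl. Qed.

HB.instance Definition _ := GRing.Zmodule_isLmodule.Build k (matalg F n)
  matalg_scaleA matalg_scale1 matalg_scaleDr matalg_scaleDl.

Fact matalg_scaleAl (c : k) (M N : matalg F n) : c *: (M * N) = (c *: M) * N.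
Proof.
apply/matrixP=> i j; rewrite !mxE scaler_sumr; apply: eq_bigr => s _.
by rewrite !mxE scalerAl.
Qed.

HB.instance Definition _ :=
  GRing.Lmodule_isLalgebra.Build k (matalg F n) matalg_scaleAl.

Fact matalg_scaleAr (c : k) (M N : matalg F n) : c *: (M * N) = M * (c *: N).
Proof.
apply/matrixP=> i j; rewrite !mxE scaler_sumr; apply: eq_bigr => s _.
by rewrite !mxE scalerAr.
Qed.

HB.instance Definition _ :=
  GRing.Lalgebra_isAlgebra.Build k (matalg F n) matalg_scaleAr.

End MatrixAlgebra.

(* The product of a nonempty finite family of k-algebras.  MathComp algebras  *)
(* are nonzero, hence the index type 'I_n.+1.                                 *)
Definition prodalg (k : fieldType) (n : nat) (A : 'I_n.+1 -> algType k) : Type :=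
  {dffun forall i, A i}.

Section ProductAlgebra.
Variables (k : fieldType) (n : nat) (A : 'I_n.+1 -> algType k).
Implicit Types x y z : prodalg A.

HB.instance Definition _ := Choice.copy (prodalg A) {dffun forall i, A i}.

Definition prodalg_of (f : forall i, A i) : prodalg A := finfun f.

Definition prodalg_add x y := prodalg_of (fun i => x i + y i).
Definition prodalg_opp x := prodalg_of (fun i => - x i).
Definition prodalg_mul x y := prodalg_of (fun i => x i * y i).
Definition prodalg_scale (c : k) x := prodalg_of (fun i => c *: x i).

Fact prodalg_addA : associative prodalg_add.
Proof. by move=> x y z; apply/ffunP=> i; rewrite !ffunE addrA. Qed.
Fact prodalg_addC : commutative prodalg_add.
Proof. by move=> x y; apply/ffunP=> i; rewrite !ffunE addrC. Qed.
Fact prodalg_add0 : left_id (prodalg_of (fun=> 0)) prodalg_add.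
Proof. by move=> x; apply/ffunP=> i; rewrite !ffunE add0r. Qed.
Fact prodalg_addN :
  left_inverse (prodalg_of (fun=> 0)) prodalg_opp prodalg_add.
Proof. by move=> x; apply/ffunP=> i; rewrite !ffunE addNr. Qed.

HB.instance Definition _ := GRing.isZmodule.Build (prodalg A)
  prodalg_addA prodalg_addC prodalg_add0 prodalg_addN.

Fact prodalg_mulA : associative prodalg_mul.
Proof. by move=> x y z; apply/ffunP=> i; rewrite !ffunE mulrA. Qed.
Fact prodalg_mul1l : left_id (prodalg_of (fun=> 1)) prodalg_mul.
Proof. by move=> x; apply/ffunP=> i; rewrite !ffunE mul1r. Qed.
Fact prodalg_mul1r : right_id (prodalg_of (fun=> 1)) prodalg_mul.
Proof. by move=> x; apply/ffunP=> i; rewrite !ffunE mulr1. Qed.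
Fact prodalg_mulDl : left_distributive prodalg_mul +%R.
Proof. by move=> x y z; apply/ffunP=> i; rewrite !ffunE mulrDl. Qed.
Fact prodalg_mulDr : right_distributive prodalg_mul +%R.
Proof. by move=> x y z; apply/ffunP=> i; rewrite !ffunE mulrDr. Qed.
Fact prodalg_1neq0 : prodalg_of (fun=> 1) != 0.
Proof. by apply/eqP=> /ffunP/(_ ord0)/eqP; rewrite !ffunE oner_eq0. Qed.

HB.instance Definition _ := GRing.Zmodule_isNzRing.Build (prodalg A)
  prodalg_mulA prodalg_mul1l prodalg_mul1r prodalg_mulDl prodalg_mulDr
  prodalg_1neq0.

Fact prodalg_scaleA a b x :
  prodalg_scale a (prodalg_scale b x) = prodalg_scale (a * b) x.
Proof. by apply/ffunP=> i; rewrite !ffunE scalerA. Qed.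
Fact prodalg_scale1 : left_id 1 prodalg_scale.
Proof. by move=> x; apply/ffunP=> i; rewrite !ffunE scale1r. Qed.
Fact prodalg_scaleDr : right_distributive prodalg_scale +%R.
Proof. by move=> c x y; apply/ffunP=> i; rewrite !ffunE scalerDr. Qed.
Fact prodalg_scaleDl x : {morph prodalg_scale^~ x : a b / a + b}.
Proof. by move=> a b; apply/ffunP=> i; rewrite !ffunE scalerDl. Qed.

HB.instance Definition _ := GRing.Zmodule_isLmodule.Build k (prodalg A)
  prodalg_scaleA prodalg_scale1 prodalg_scaleDr prodalg_scaleDl.

Fact prodalg_scaleAl (c : k) x y : c *: (x * y) = (c *: x) * y.
Proof. by apply/ffunP=> i; rewrite !ffunE scalerAl. Qed.

HB.instance Definition _ :=
  GRing.Lmodule_isLalgebra.Build k (prodalg A) prodalg_scaleAl.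

Fact prodalg_scaleAr (c : k) x y : c *: (x * y) = x * (c *: y).
Proof. by apply/ffunP=> i; rewrite !ffunE scalerAr. Qed.

HB.instance Definition _ :=
  GRing.Lalgebra_isAlgebra.Build k (prodalg A) prodalg_scaleAr.

End ProductAlgebra.

Definition division (A : unitRingType) : Prop :=
  forall x : A, x != 0 -> x \is a GRing.unit.

Definition alg_isomorphic (k : fieldType) (A B : algType k) : Prop :=
  exists f : {lrmorphism A -> B}, bijective f.

Definition basic (k : fieldType) (A : algType k) : Prop :=
  exists (n : nat) (D : 'I_n.+1 -> falgType k),
    (forall i, division (D i)) /\
    alg_isomorphic A (prodalg (fun i => D i : algType k)).

Definition similar_morphism (A : Type) (B : nzRingType) (f g : A -> B) : Prop :=
  exists b b' : B,
    [/\ b * b' = 1, b' * b = 1 & forall a, g a = b * f a * b'].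

Definition simple_module (R : nzRingType) (U : lmodType R) : Prop :=
  (exists u : U, u != 0) /\
  forall S : {pred U}, submod_closed S ->
    (forall u, u \in S -> u = 0) \/ (forall u, u \in S).

(* The length of M is the supremum of the lengths l of the strictly           *)
(* increasing chains S_0 < ... < S_l of submodules.                           *)
Definition length_le (R : nzRingType) (M : lmodType R) (n : nat) : Prop :=
  forall (l : nat) (S : 'I_l.+1 -> {pred M}),
    (forall i, submod_closed (S i)) ->
    (forall i j : 'I_l.+1, (i < j)%N ->
       {subset S i <= S j} /\ ~ {subset S j <= S i}) ->
    (l <= n)%N.

Section Nodal.
Variables (k : fieldType) (A B : algType k) (phi : {lrmorphism A -> B}).

Definition balanced (U : lmodType A) (W : zmodType) (s : B -> U -> W) : Prop :=
  [/\ forall u, zmod_morphism (s^~ u),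
      forall g, zmod_morphism (s g) &
      forall g a u, s (g * phi a) u = s g (a *: u)].

(* T with t is the tensor product of B, as a right A-module via phi, and U;   *)
(* A acts on T through phi and the left multiplication of B.                  *)
Definition is_tensor (U T : lmodType A) (t : B -> U -> T) : Prop :=
  [/\ balanced t,
      forall a g u, t (phi a * g) u = a *: t g u &
      forall (W : zmodType) (s : B -> U -> W), balanced s ->
        exists h : {additive T -> W},
          (forall g u, h (t g u) = s g u) /\
          forall h' : {additive T -> W},
            (forall g u, h' (t g u) = s g u) -> h' =1 h].

(* As tensor products exist and are unique up to isomorphism, it does not     *)
(* matter that T is bound existentially.                                      *)
Definition nodal_embedding : Prop :=
  injective phi /\
  forall U : lmodType A, simple_module U ->
    exists (T : lmodType A) (t : B -> U -> T), is_tensor t /\ length_le T 2.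

End Nodal.

Section RegularEmbedding.
Variables (k : fieldType) (K L : falgType k) (iota : {lrmorphism K -> L}).
Variables (n : nat) (e : 'I_n -> L).

Definition right_basis : Prop :=
  forall x : L, exists! c : 'cV[K]_n, x = \sum_s e s * iota (c s ord0).

Definition regular_embedding (f : L -> 'M[K]_n) : Prop :=
  forall a t, a * e t = \sum_s e s * iota (f a s t).

End RegularEmbedding.

(* Here f is a map from A to the product of the M_{r t}(F t), for t : 'I_q,   *)
(* given by its components.  A division algebra F occurring as a factor of    *)
(* the target is identified with M_1(F) by x |-> x%:M.                        *)
Inductive elementary (k : fieldType) :
  forall (A : algType k) (q : nat) (F : 'I_q -> falgType k) (r : 'I_q -> nat),
    (A -> forall t, matalg (F t) (r t)) -> Prop :=
| Elem_id (F : falgType k) of division F :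
    @elementary k F 1 (fun=> F) (fun=> 1%N) (fun a _ => a%:M)
| Elem_twist (F : falgType k) (tau : {lrmorphism F -> F})
    of division F & bijective tau :
    @elementary k F 2 (fun=> F) (fun=> 1%N)
      (fun a t => if t == ord0 then a%:M else (tau a)%:M)
| Elem_extension (K L : falgType k) (iota : {lrmorphism K -> L})
    of division K & division L & \dim {:L} = (2 * \dim {:K})%N :
    @elementary k K 1 (fun=> L) (fun=> 1%N) (fun a _ => (iota a)%:M)
| Elem_diagonal (F : falgType k) of division F :
    @elementary k (F * F)%type 1 (fun=> F) (fun=> 2%N)
      (fun a _ => block_mx (a.1%:M : 'M_1) 0 0 (a.2%:M : 'M_1))
| Elem_regular (K L : falgType k) (iota : {lrmorphism K -> L})
    (e : 'I_2 -> L) (f : L -> 'M[K]_2)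
    of division K & division L & \dim {:L} = (2 * \dim {:K})%N &
       right_basis iota e & regular_embedding iota e f :
    @elementary k L 1 (fun=> K) (fun=> 2%N) (fun a _ => f a).

(* psi is a product of elementary embeddings f_b : A_b -> Gamma_b, where      *)
(* theta identifies the source with the product of the A_b, and sigma groups  *)
(* the factors of the target, sigma b enumerating those of Gamma_b.           *)
Definition elementary_product (k : fieldType) (A : algType k) (m : nat)
    (F : 'I_m.+1 -> falgType k) (r : 'I_m.+1 -> nat)
    (psi : A -> prodalg (fun j => matalg (F j) (r j) : algType k)) : Prop :=
  exists (p : nat) (Ab : 'I_p.+1 -> algType k)
         (theta : {lrmorphism A -> prodalg Ab})
         (q : 'I_p.+1 -> nat) (sigma : forall b, 'I_(q b) -> 'I_m.+1)
         (f : forall b, Ab b ->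
              forall t, matalg (F (sigma b t)) (r (sigma b t))),
    [/\ bijective theta,
        bijective (fun x : {b : 'I_p.+1 & 'I_(q b)} => sigma (tag x) (tagged x)),
        forall b, elementary (f b) &
        forall a b t, psi a (sigma b t) = f b (theta a b) t].

(* Main.v *)
(** Let [e i] be the central idempotents of [Lambda], a product of division
    algebras [D i], and let [E i j] be the [j]-th component of [phi (e i)]. Since
    [Gamma (x) U_i] is [Gamma phi(e i)], nodality says that among any three
    elements of [Gamma phi(e i)] one is a [Lambda]-combination of its
    predecessors. Let [V_j] be the column space of [Gamma_j].
    If [Lambda] acts transitively on the nonzero vectors of [V_j], then
    [E i j = 1] for a single [i] and the rank of [Gamma_j] is at most 2; rank 2
    gives type (5), and rank 1 gives type (1) or (2) according to the number of
    factors [j] met by [e i]. Otherwise [V_j] has length 2, each [e i] with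
    [E i j != 0] meets no other factor and [E i j] has rank one; one such [i]
    gives type (3), two give type (4). *)
Require Import Defs.
From HB Require Import structures.
From mathcomp Require Import all_boot all_order all_algebra all_field boolp.

Set Implicit Arguments.
Unset Strict Implicit.
Unset Printing Implicit Defensive.

Import GRing.Theory.
Local Open Scope ring_scope.

(** * Algebra homomorphisms and division algebras *)

Lemma lrmorphism_of (k : fieldType) (A B : algType k) (f : A -> B) :
  linear f -> monoid_morphism f -> {g : {lrmorphism A -> B} | g =1 f}.
Proof.
move=> lin_f mul_f.
pose fL := GRing.isLinear.Build k A B *:%R f lin_f.
pose fM := GRing.isMonoidMorphism.Build A B f mul_f.
by exists (HB.pack_for {lrmorphism A -> B} f fL fM).
Qed.

(** [h] is constant on the fibres of [p], so [h \o s] is an algebra homomorphism even though the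
    chosen section [s] need not be one. *)
Lemma lrmorphism_factor (k : fieldType) (A B C : algType k)
    (p : {lrmorphism A -> B}) (h : {lrmorphism A -> C}) :
    (forall b, exists a, p a = b) -> (forall a, p a = 0 -> h a = 0) ->
  {g : {lrmorphism B -> C} | forall a, g (p a) = h a}.
Proof.
move=> p_surj ker_p; pose s b := sval (cid (p_surj b)).
have sK b : p (s b) = b by rewrite /s; case: cid.
have hs a b : p a = p b -> h a = h b.
  move=> pab; apply: subr0_eq; rewrite -linearB; apply: ker_p.
  by rewrite linearB /= pab subrr.
have [||g gE] := @lrmorphism_of k B C (h \o s).
- move=> c x y; rewrite /= -linearP; apply: hs.
  by rewrite sK linearP /= !sK.
- split=> [|x y] /=; first by rewrite -(rmorph1 h); apply: hs; rewrite sK rmorph1.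
  by rewrite -rmorphM; apply: hs; rewrite rmorphM /= !sK.
by exists g => a; rewrite gE /=; apply: hs; rewrite sK.
Qed.

Lemma division_rmorph_inj (A : unitRingType) (B : nzRingType)
    (f : {rmorphism A -> B}) : division A -> injective f.
Proof.
move=> divA; apply: raddf_inj => x fx0; apply/eqP/negPn/negP => /divA Ux.
by move/eqP: (oner_neq0 B); rewrite -(rmorph1 f) -(mulrV Ux) rmorphM /= fx0 mul0r.
Qed.

Lemma division_mulf_eq0 (A : unitRingType) (x y : A) :
  division A -> x * y = 0 -> x != 0 -> y = 0.
Proof. by move=> divA xy /divA Ux; rewrite -(mulKr Ux y) xy mulr0. Qed.

Lemma inj_surj_bij (S T : Type) (f : S -> T) :
  injective f -> (forall y, exists x, f x = y) -> bijective f.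
Proof.
move=> f_inj /choice[g gK]; exists g => // x.
by apply: f_inj; rewrite gK.
Qed.

Lemma ord2_max (t : 'I_2) : t != ord0 -> t = ord_max.
Proof. by move=> t0; apply: val_inj; case: t t0 => -[|[]]. Qed.

(** * Dimension counts over the ground field, and length *)

Lemma linear_inj_dim (k : fieldType) (U V : vectType k) (f : U -> V) :
  linear f -> injective f -> (\dim {:U} <= \dim {:V})%N.
Proof.
move=> lin_f inj_f.
pose fL := HB.pack_for {linear U -> V} f (GRing.isLinear.Build k U V *:%R f lin_f).
have /lker0P/eqP ker0 : injective (linfun fL).
  by move=> x y; rewrite !lfunE; apply: inj_f.
rewrite -(limg_dim_eq (f := linfun fL) (U := fullv)) ?ker0 ?capv0 //.
exact/dimvS/subvf.
Qed.

Lemma linear_bij_dim (k : fieldType) (U V : vectType k) (f : U -> V) :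
  linear f -> bijective f -> \dim {:U} = \dim {:V}.
Proof.
move=> lin_f [g fK gK].
apply/eqP; rewrite eqn_leq (linear_inj_dim lin_f (can_inj fK)) /=.
apply: (@linear_inj_dim _ _ _ g); last exact: can_inj gK.
by move=> c x y; apply: (can_inj fK); rewrite gK lin_f !gK.
Qed.

Lemma dim_prod (k : fieldType) (U V : vectType k) :
  \dim {:(U * V)%type} = (\dim {:U} + \dim {:V})%N.
Proof. by rewrite !dimvf. Qed.

Lemma dim_ffun (k : fieldType) (I : finType) (V : vectType k) :
  \dim {:{ffun I -> V}} = (#|I| * \dim {:V})%N.
Proof. by rewrite !dimvf. Qed.

(** As [F] may be noncommutative, dimensions over [k] are compared: multiplying columns by [Y] is
    injective, with left inverse the multiplication by [X], and [\dim {:F}] is nonzero because [F]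
    contains [1]. *)
Lemma mulmx1_leq (k : fieldType) (F : falgType k) (r s : nat)
    (X : 'M[F]_(r, s)) (Y : 'M[F]_(s, r)) : X *m Y = 1%:M -> (r <= s)%N.
Proof.
move=> XY; pose f (v : {ffun 'I_r -> F}) : {ffun 'I_s -> F} :=
  [ffun i => \sum_t Y i t * v t].
have lin_f : linear f.
  move=> c u v; apply/ffunP=> i; rewrite !ffunE scaler_sumr -big_split /=.
  by apply: eq_bigr => t _; rewrite !ffunE mulrDr scalerAr.
have inj_f : injective f.
  pose g (w : {ffun 'I_s -> F}) : {ffun 'I_r -> F} :=
    [ffun i => \sum_t X i t * w t].
  apply: (@can_inj _ _ _ g) => v; apply/ffunP=> i; rewrite !ffunE.
  under eq_bigr do rewrite ffunE mulr_sumr.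
  rewrite exchange_big /=; transitivity (\sum_t (X *m Y) i t * v t).
    apply: eq_bigr => t _; rewrite mxE mulr_suml.
    by apply: eq_bigr => u _; rewrite mulrA.
  rewrite XY (bigD1 i) //= mxE eqxx mul1r big1 ?addr0 // => t ti.
  by rewrite mxE eq_sym (negPf ti) mul0r.
have := linear_inj_dim lin_f inj_f; rewrite !dim_ffun !card_ord leq_pmul2r //.
by rewrite lt0n dimv_eq0 -subv0; apply/negP => /subvP/(_ 1 (memvf _));
  rewrite memv0 oner_eq0.
Qed.

(** If none of [w 0], ..., [w n] depended on its predecessors, the spans [P i] of the first [i]
    terms would increase strictly from [i = 0] to [i = n.+1], a chain that is too long. *)
Lemma length_le_dependent (R : nzRingType) (M : lmodType R) n (w : nat -> M) :
    length_le M n ->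
  exists2 i, (i <= n)%N & exists c : nat -> R, w i = \sum_(s < i) c s *: w s.
Proof.
move=> lenM; apply: contrapT => free_w.
pose P i x := exists c : nat -> R, x = \sum_(s < i) c s *: w s.
have PS (i j : nat) x : (i <= j)%N -> P i x -> P j x.
  move=> le_ij [c ->]; exists (fun s => if (s < i)%N then c s else 0).
  rewrite (big_ord_widen j (fun s => c s *: w s)) // big_mkcond.
  by apply: eq_bigr => s _; case: ifP; rewrite ?scale0r.
have Pw i : P i.+1 (w i).
  exists (fun s => (s == i)%:R); rewrite big_ord_recr /= eqxx scale1r big1 ?add0r //.
  by move=> s _; rewrite ltn_eqF // scale0r.
have: (n.+1 <= n)%N; last by rewrite ltnn.
apply: (lenM n.+1 (fun i => [pred x | `[< P i x >]])) => [i | i j ij].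
  split=> [|a x y]; rewrite !inE.
    by apply/asboolP; exists (fun=> 0); rewrite big1 // => s _; rewrite scale0r.
  move=> /asboolP[c ->] /asboolP[d ->]; apply/asboolP.
  exists (fun s => a * c s + d s); rewrite scaler_sumr -big_split /=.
  by apply: eq_bigr => s _; rewrite scalerDl scalerA.
split=> [x | /(_ (w i))]; rewrite !inE.
  by move=> /asboolP Pi; apply/asboolP/(PS i); rewrite // ltnW.
(* Strictness is witnessed by [w i], which lies in [P i.+1] and hence in [P j]. *)
move=> Pji; case: free_w; exists i.
  by have := ltn_ord j; rewrite ltnS => /(leq_trans ij).
by apply/asboolP/Pji/asboolP/(PS i.+1).
Qed.

(** * Simple modules from division quotients, and nodality *)

Definition restriction (R S : nzRingType) (p : {rmorphism R -> S}) : Type := S.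

Section Restriction.
Variables (R S : nzRingType) (p : {rmorphism R -> S}).

HB.instance Definition _ := GRing.Zmodule.copy (restriction p) S.

Definition restriction_scale (a : R) (u : restriction p) : restriction p :=
  (p a * u : S).

Fact restriction_scaleA a b u :
  restriction_scale a (restriction_scale b u) = restriction_scale (a * b) u.
Proof. by rewrite /restriction_scale rmorphM mulrA. Qed.
Fact restriction_scale1 : left_id 1 restriction_scale.
Proof. by move=> u; rewrite /restriction_scale rmorph1 mul1r. Qed.
Fact restriction_scaleDr : right_distributive restriction_scale +%R.
Proof. by move=> a u v; exact: (mulrDr (p a) u v). Qed.
Fact restriction_scaleDl u : {morph restriction_scale^~ u : a b / a + b}.
Proof. by move=> a b; rewrite /restriction_scale rmorphD; exact: mulrDl. Qed.

HB.instance Definition _ := GRing.Zmodule_isLmodule.Build R (restriction p)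
  restriction_scaleA restriction_scale1 restriction_scaleDr restriction_scaleDl.

End Restriction.

(** A nonzero [u] is invertible, so lifting [v / u] along [p] gives a scalar carrying [u] to [v].
    Nodality is tested on the simple modules obtained in this way from the factors of [Lambda]. *)
Lemma restriction_simple (R : nzRingType) (S : unitRingType)
    (p : {rmorphism R -> S}) :
  division S -> (forall b, exists a, p a = b) ->
  simple_module (restriction p : lmodType R).
Proof.
move=> divS p_surj; split; first by exists (1 : S); exact: oner_neq0.
move=> P [P0 Plin].
have [[u [u0 Pu]]|noP] := pselect (exists u : restriction p, u != 0 /\ u \in P).
  right=> v; have [a pa] := p_surj ((v : S) / (u : S)).
  have: a *: u + 0 \in P by apply: Plin.
  rewrite addr0; suff -> : a *: u = v by [].
  by rewrite -[LHS]/(p a * (u : S)) pa divrK //; apply: divS.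
left=> u Pu; apply/eqP/negPn/negP => u0.
by case: noP; exists u.
Qed.

(* Mapping [g (x) u] to [g * phi (lift u)] sends the tensor product onto       *)
(* [Gamma * phi e], so generation statements descend to the latter.           *)
Lemma nodal_dependent (k : fieldType) (A B : algType k) (phi : {lrmorphism A -> B})
    (D : falgType k) (p : {lrmorphism A -> D}) (e : A) :
    nodal_embedding phi -> division D -> (forall d, exists a, p a = d) ->
    p e = 1 -> (forall a, p a = 0 -> a * e = 0) ->
  forall w : 'I_3 -> B, (forall s, w s * phi e = w s) ->
  [\/ w ord0 = 0, exists a, w (inord 1) = phi a * w ord0
    | exists a b, w (inord 2) = phi a * w ord0 + phi b * w (inord 1)].
Proof.
move=> [_ nodal] divD p_surj pe ker_p w we.
have [T [t [[_ t_lin t_univ] lenT]]] := nodal _ (restriction_simple divD p_surj).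
have [lift liftK] := choice p_surj.
(* [lift] is an arbitrary section; multiplication by [e] removes the dependence on the choice. *)
have liftE a d : p a = d -> lift d * e = a * e.
  move=> pa; apply: subr0_eq; rewrite -mulrBl; apply: ker_p.
  by rewrite linearB /= liftK pa subrr.
pose s (g : B) (u : restriction p) := g * phi (lift u * e).
(* The extra factor [b] lets one statement serve both for [h], with [b = 1], and for its linearity,
   with [b = phi a]. *)
have bal_s b : balanced phi (fun g u => b * s g u).
  split=> [u g g'|g u v|g a u].
  - by rewrite /s mulrBl mulrBr.
  - rewrite /s -mulrBr -mulrBr -rmorphB -mulrBl (@liftE (lift u - lift v)) //.
    by rewrite linearB /= !liftK.
  rewrite /s -[g * _ * _]mulrA -rmorphM [a * _]mulrA.
  by rewrite (@liftE (a * lift u) (a *: u)) // rmorphM /= liftK.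
have [h [hE _]] := t_univ _ _ (bal_s 1).
have h_lin a z : h (a *: z) = phi a * h z.
  have [ha [_ ha_uniq]] := t_univ _ _ (bal_s (phi a)).
  (* Scaling by [a] before [h] and multiplying by [phi a] after [h] solve the same universal
     problem. *)
  transitivity (ha z); last apply/esym.
    apply: (ha_uniq (h \o ( *:%R a) : {additive T -> B})) => g u /=.
    by rewrite -t_lin hE /s mul1r mulrA.
  apply: (ha_uniq (phi a \*o h : {additive T -> B})) => g u /=.
  by rewrite hE mul1r.
have h_surj s' : exists z, h z = w s'.
  exists (t (w s') (1 : D)); rewrite hE mul1r /s.
  by rewrite (liftE 1) ?rmorph1 // mul1r.
have [z zE] := choice h_surj.
have [i] := length_le_dependent (fun i => z (inord i)) lenT.
have z0 : inord 0 = ord0 :> 'I_3 by apply: val_inj; rewrite /= inordK.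
case: i => [|[|[|//]]] _ [c]; rewrite ?big_ord_recr ?big_ord0 /= ?add0r ?z0 => zc.
- by constructor 1; rewrite -zE zc raddf0.
- by constructor 2; exists (c 0%N); rewrite -!zE zc h_lin.
by constructor 3; exists (c 0%N), (c 1%N); rewrite -!zE zc raddfD /= !h_lin.
Qed.

(** * Projections, pairings and factor inclusions of product algebras *)

Section ProductMaps.
Variables (k : fieldType) (n : nat) (A : 'I_n.+1 -> algType k).

Definition prodalg_eval i (x : prodalg A) : A i := x i.

Fact prodalg_eval_linear i : linear (prodalg_eval i).
Proof. by move=> c x y; rewrite /prodalg_eval !ffunE. Qed.
Fact prodalg_eval_monoid i : monoid_morphism (prodalg_eval i).
Proof. by split=> [|x y]; rewrite /prodalg_eval !ffunE. Qed.

HB.instance Definition _ i :=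
  GRing.isLinear.Build k (prodalg A) (A i) *:%R (prodalg_eval i)
    (prodalg_eval_linear i).
HB.instance Definition _ i :=
  GRing.isMonoidMorphism.Build (prodalg A) (A i) (prodalg_eval i)
    (prodalg_eval_monoid i).

Definition prodalg_pair (B : algType k) (f : forall i, {lrmorphism B -> A i}) :=
  fun b => prodalg_of (fun i => f i b).

Variables (B : algType k) (f : forall i, {lrmorphism B -> A i}).

Fact prodalg_pair_linear : linear (prodalg_pair f).
Proof. by move=> c x y; apply/ffunP=> i; rewrite !ffunE linearP. Qed.
Fact prodalg_pair_monoid : monoid_morphism (prodalg_pair f).
Proof.
by split=> [|x y]; apply/ffunP=> i; rewrite !ffunE ?rmorph1 ?rmorphM.
Qed.

HB.instance Definition _ :=
  GRing.isLinear.Build k B (prodalg A) *:%R (prodalg_pair f) prodalg_pair_linear.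
HB.instance Definition _ :=
  GRing.isMonoidMorphism.Build B (prodalg A) (prodalg_pair f) prodalg_pair_monoid.

Definition prodalg_single i (x : A i) : prodalg A :=
  prodalg_of (dfwith (fun=> 0) x).

Lemma prodalg_single_in i (x : A i) : prodalg_single x i = x.
Proof. by rewrite ffunE dfwith_in. Qed.

Lemma prodalg_single_out i (x : A i) j : i != j -> prodalg_single x j = 0.
Proof. by move=> ij; rewrite ffunE dfwith_out. Qed.

Lemma prodalg_mul_single i x (y : A i) :
  x * prodalg_single y = prodalg_single (x i * y).
Proof.
apply/ffunP=> j; rewrite !ffunE.
by have [<-|ij] := eqVneq i j; rewrite ?dfwith_in // !dfwith_out ?mulr0.
Qed.

Lemma prodalg_single_mul i x (y : A i) :
  prodalg_single y * x = prodalg_single (y * x i).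
Proof.
apply/ffunP=> j; rewrite !ffunE.
by have [<-|ij] := eqVneq i j; rewrite ?dfwith_in // !dfwith_out ?mul0r.
Qed.

Lemma prodalg_single_inj i : injective (@prodalg_single i).
Proof.
move=> x y /(congr1 (@prodalg_eval i)).
by rewrite /prodalg_eval !prodalg_single_in.
Qed.

Lemma prodalg_singleD i (x y : A i) :
  prodalg_single (x + y) = prodalg_single x + prodalg_single y.
Proof.
apply/ffunP=> j; rewrite !ffunE.
by have [<-|ij] := eqVneq i j; rewrite ?dfwith_in // !dfwith_out ?addr0.
Qed.

Lemma prodalg_single0 i : prodalg_single (0 : A i) = 0.
Proof.
by apply: (addrI (prodalg_single (0 : A i))); rewrite -prodalg_singleD !addr0.
Qed.

End ProductMaps.

(** * Vectors over a division algebra *)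

Section DivisionVectors.
Variables (F : unitRingType) (n : nat).
Hypothesis divF : division F.

(** The inverse column is supported at one coordinate where [y] is nonzero. *)
Lemma division_row_inv (y : 'rV[F]_n) : y != 0 -> exists z, y *m z = 1%:M.
Proof.
move=> y0; have [s ys] : exists s, y ord0 s != 0.
  apply: contrapT => noy; case/eqP: y0; apply/rowP=> s; rewrite mxE.
  by apply/eqP/negPn/negP => ys; case: noy; exists s.
exists (\col_t ((t == s)%:R * (y ord0 s)^-1)); apply/matrixP=> i j.
rewrite !mxE !ord1 (bigD1 s) //= big1 => [|t ts].
  by rewrite mxE eqxx mul1r addr0 mulrV //; apply: divF.
by rewrite mxE (negPf ts) mul0r mulr0.
Qed.

Lemma division_col_inv (x : 'cV[F]_n) : x != 0 -> exists z, z *m x = 1%:M.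
Proof.
move=> x0; have [s xs] : exists s, x s ord0 != 0.
  apply: contrapT => nox; case/eqP: x0; apply/colP=> s; rewrite mxE.
  by apply/eqP/negPn/negP => xs; case: nox; exists s.
exists (\row_t ((x s ord0)^-1 * (t == s)%:R)); apply/matrixP=> i j.
rewrite !mxE !ord1 (bigD1 s) //= big1 => [|t ts].
  by rewrite mxE eqxx mulr1 addr0 mulVr //; apply: divF.
by rewrite mxE (negPf ts) mulr0 mul0r.
Qed.

End DivisionVectors.

Lemma mx_neq0_row (R : nzRingType) p q (M : 'M[R]_(p, q)) :
  M != 0 -> exists s, row s M != 0.
Proof.
move=> M0; apply: contrapT => noM; case/eqP: M0; apply/row_matrixP=> s.
by rewrite row0; apply/eqP/negPn/negP => Ms; case: noM; exists s.
Qed.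

Lemma mx_neq0_col (R : nzRingType) p q (M : 'M[R]_(p, q)) :
  M != 0 -> exists s, col s M != 0.
Proof.
move=> M0; apply: contrapT => noM; case/eqP: M0; apply/matrixP=> i s.
have [cs | cs] := eqVneq (col s M) 0; first by move/colP/(_ i): cs; rewrite !mxE.
by case: noM; exists s.
Qed.

Lemma mulmx_cV_inj (R : nzRingType) p q (M N : 'M[R]_(p, q)) :
  (forall x : 'cV_q, M *m x = N *m x) -> M = N.
Proof.
move=> MN; apply/matrixP=> i j; have := MN (delta_mx j ord0).
move=> /colP/(_ i); rewrite !mxE (bigD1 j) //= big1 => [|s sj]; last first.
  by rewrite mxE (negPf sj) mulr0.
rewrite (bigD1 j) //= big1 => [|s sj]; last by rewrite mxE (negPf sj) mulr0.
by rewrite !mxE !eqxx !mulr1 !addr0.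
Qed.

(* A basic algebra is handled through its projections [p i] onto the division *)
(* algebras [D i], which are jointly injective and jointly surjective.        *)
Lemma basic_projections (k : fieldType) (A : algType k) : basic A ->
  exists n (D : 'I_n.+1 -> falgType k) (p : forall i, {lrmorphism A -> D i}),
    [/\ forall i, division (D i), forall a, (forall i, p i a = 0) -> a = 0
      & forall d : (forall i, D i), exists a, forall i, p i a = d i].
Proof.
move=> [n [D [divD [f f_bij]]]]; exists n, D.
exists (fun i => prodalg_eval i \o f : {lrmorphism A -> D i}); split=> //.
  move=> a a0; apply: (bij_inj f_bij); rewrite linear0; apply/ffunP=> i.
  by rewrite ffunE; apply: a0.
move=> d; case: f_bij => g _ gK.
exists (g (prodalg_of (A := fun i => D i : algType k) d)) => i.
by rewrite /= gK /prodalg_eval ffunE.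
Qed.

(** * Recognizing the elementary embeddings *)

Section Realization.
Variables (k : fieldType) (Lambda : algType k).

(** The map [th] identifies the quotient of [Lambda] by [ker] with the source of an elementary
    embedding. Keeping [ker] as a separate predicate allows it to be rewritten in terms of the
    projections of [Lambda]. *)
Definition realizes q (F : 'I_q -> falgType k) (r : 'I_q -> nat)
    (g : Lambda -> forall t, matalg (F t) (r t)) (ker : Lambda -> Prop) :=
  exists (A : algType k) (th : {lrmorphism Lambda -> A})
         (f : A -> forall t, matalg (F t) (r t)),
    [/\ elementary f, forall a t, g a t = f (th a) t,
        forall y, exists a, th a = y & forall a, th a = 0 <-> ker a].

(** This is simplicity of the column space as a [Lambda]-module. *)
Definition acts_transitively (F : falgType k) r
    (g : {lrmorphism Lambda -> matalg F r}) :=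
  forall x0 x1 : 'cV[F]_(r.-1.+1), x0 != 0 ->
    exists a, x1 = (g a : 'M_(r.-1.+1)) *m x0.

Lemma matalg1_entry (F : falgType k) (g : {lrmorphism Lambda -> matalg F 1}) :
  exists h : {lrmorphism Lambda -> F}, forall a, g a = (h a)%:M.
Proof.
have [||h hE] := @lrmorphism_of k Lambda F (fun a => (g a : 'M_1) ord0 ord0).
- by move=> c x y; rewrite linearP !mxE.
- split=> [|x y]; first by rewrite rmorph1 mxE.
  by rewrite rmorphM /= mxE big_ord1.
by exists h => a; rewrite hE; exact: mx11_scalar.
Qed.

Lemma scalar_mx1_inj (R : nzRingType) : injective (@scalar_mx R 1).
Proof. by move=> x y /matrixP/(_ ord0 ord0); rewrite !mxE eqxx. Qed.

Lemma scalar_mx1_eq0 (R : nzRingType) (x : R) : (x%:M : 'M_1) = 0 <-> x = 0.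
Proof.
split=> [|->]; last by rewrite raddf0.
by rewrite -(raddf0 (@scalar_mx R 1)) => /scalar_mx1_inj.
Qed.

Lemma transitive1_surj (F : falgType k) (g : {lrmorphism Lambda -> matalg F 1})
    (h : {lrmorphism Lambda -> F}) :
  (forall a, g a = (h a)%:M) -> acts_transitively g ->
  forall y, exists a, h a = y.
Proof.
move=> hE trg y; have [|a] := trg 1%:M y%:M; first exact: matrix_nonzero1.
by rewrite mulmx1 hE => /scalar_mx1_inj ->; exists a.
Qed.

(** In rank one transitivity makes [g] surjective, so [F] is the quotient of [Lambda] by its
    kernel. *)
Lemma realizes_id (F : falgType k) r (g : {lrmorphism Lambda -> matalg F r}) :
    division F -> r = 1%N -> acts_transitively g ->
  @realizes 1 (fun=> F) (fun=> r) (fun a _ => g a) (fun a => g a = 0).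
Proof.
move=> divF r1; subst r => trg; have [h hE] := matalg1_entry g.
exists F, h, (fun a _ => a%:M); split=> //.
- exact: Elem_id.
- exact: transitive1_surj hE trg.
by move=> a; rewrite hE; split=> /scalar_mx1_eq0.
Qed.

(** Both components are onto [F0] with the same kernel, so the second factors through the first by
    an automorphism [tau]. *)
Lemma realizes_twist (F : 'I_2 -> falgType k) (r : 'I_2 -> nat) (F0 : falgType k)
    (g : forall t, {lrmorphism Lambda -> matalg (F t) (r t)}) (ker : Lambda -> Prop) :
    division F0 -> (forall t, F t = F0) -> (forall t, r t = 1%N) ->
    (forall t, acts_transitively (g t)) -> (forall t a, g t a = 0 <-> ker a) ->
  @realizes 2 F r (fun a t => g t a) ker.
Proof.
(* [elementary] is indexed by whole families, so [F] and [r] are first replaced by constant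
   functions. *)
move=> divF0 /funext eF /funext er; subst F r => trg ker_g.
have [h0 h0E] := matalg1_entry (g ord0).
have [h1 h1E] := matalg1_entry (g ord_max).
have ker0 a : h0 a = 0 <-> ker a by rewrite -(ker_g ord0) h0E scalar_mx1_eq0.
have ker1 a : h1 a = 0 <-> ker a by rewrite -(ker_g ord_max) h1E scalar_mx1_eq0.
have h0_surj := transitive1_surj h0E (trg ord0).
have h1_surj := transitive1_surj h1E (trg ord_max).
have ker01 a : h0 a = 0 -> h1 a = 0 by rewrite ker0 ker1.
have [tau tauE] := lrmorphism_factor h0_surj ker01.
exists F0, h0, (fun a t => if t == ord0 then a%:M else (tau a)%:M); split=> //.
- apply: Elem_twist => //; apply: inj_surj_bij; first exact: division_rmorph_inj.
  by move=> y; have [a <-] := h1_surj y; exists (h0 a).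
move=> a t; have [->|t0] := eqVneq t ord0; first exact: h0E.
by rewrite (ord2_max t0) tauE; exact: h1E.
Qed.

(** The pair [x0], [x1] is a basis of [L] as a left [K]-space: a relation with [b] nonzero would
    make [x1] a multiple of [x0], and one with [b = 0] forces [a = 0]. *)
Lemma dim_extension2 (K L : falgType k) (iota : {lrmorphism K -> L}) (x0 x1 : L) :
    division K -> division L -> x0 != 0 -> (forall a, x1 <> iota a * x0) ->
    (forall x2, exists a b, x2 = iota a * x0 + iota b * x1) ->
  \dim {:L} = (2 * \dim {:K})%N.
Proof.
move=> divK divL x0N x1N gen.
pose f (c : (K * K)%type) := iota c.1 * x0 + iota c.2 * x1.
have lin_f : linear f.
  move=> c x y; rewrite /f !linearP !mulrDl scalerDr -!scalerAl.
  by rewrite addrACA.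
rewrite mul2n -addnn -dim_prod; apply/esym/(linear_bij_dim lin_f).
apply: inj_surj_bij => [x y xy | y]; last first.
  by have [a [b ->]] := gen y; exists (a, b).
suff: x - y = 0 by move/subr0_eq.
have: f (x - y) = 0 by rewrite addrC -scaleN1r lin_f xy scaleN1r addNr.
case: (x - y) => a b; rewrite /f /= => fab.
have [b0|bN] := eqVneq b 0.
  move: fab; rewrite b0 rmorph0 mul0r addr0 => ax0; congr (_, _).
  apply: (division_rmorph_inj divK (f := iota)).
  rewrite rmorph0; apply/eqP/negPn/negP => aN.
  by move/eqP: x0N; apply; apply: division_mulf_eq0 ax0 aN.
case: (x1N (- (b^-1 * a))); rewrite rmorphN rmorphM /= mulNr -mulrA.
move/eqP: fab; rewrite addr_eq0 => /eqP ->.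
by rewrite mulrN opprK mulrA -rmorphM mulVr ?rmorph1 ?mul1r //; apply: divK.
Qed.

(** Failure of transitivity provides [x0] and an [x1] outside its orbit; length at most 2 then makes
    them generate, so [L] has exactly twice the dimension of [K], with [L] here being [F]. *)
Lemma realizes_extension (K F : falgType k) r
    (g : {lrmorphism Lambda -> matalg F r}) (p : {lrmorphism Lambda -> K}) :
    division K -> division F -> r = 1%N ->
    (forall d, exists a, p a = d) -> (forall a, p a = 0 <-> g a = 0) ->
    ~ acts_transitively g ->
    (forall x0 x1 x2 : 'cV[F]_(r.-1.+1),
      [\/ x0 = 0, exists a, x1 = (g a : 'M_(r.-1.+1)) *m x0
        | exists a b, x2 = (g a : 'M_(r.-1.+1)) *m x0 + (g b : 'M_(r.-1.+1)) *m x1]) ->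
  @realizes 1 (fun=> F) (fun=> r) (fun a _ => g a) (fun a => g a = 0).
Proof.
move=> divK divF r1; subst r => p_surj ker_p ntr len2.
have [h hE] := matalg1_entry g.
have ker_h a : p a = 0 -> h a = 0 by rewrite ker_p hE scalar_mx1_eq0.
have [iota iotaE] := lrmorphism_factor p_surj ker_h.
exists K, p, (fun a _ => (iota a)%:M); split=> //; last first.
  by move=> a t; rewrite iotaE hE.
apply: Elem_extension => //.
have [x0 [x1 [x0N x1N]]] : exists x0 x1 : 'cV[F]_1,
    x0 != 0 /\ forall a, x1 <> (g a : 'M_1) *m x0.
  apply: contrapT => none; apply: ntr => x0 x1 x0N.
  apply: contrapT => no_a; case: none; exists x0, x1; split=> // a x1E.
  by apply: no_a; exists a.
apply: (@dim_extension2 _ _ iota (x0 ord0 ord0) (x1 ord0 ord0)) => //.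
- apply: contraNneq x0N => x00; apply/eqP/matrixP=> s t.
  by rewrite !ord1 x00 mxE.
- move=> d; have [a <-] := p_surj d; rewrite iotaE => x1E; apply: (x1N a).
  by rewrite hE; apply/matrixP=> s t; rewrite !ord1 mul_scalar_mx mxE.
move=> y; have [x00|[a /x1N //]|[a [b yE]]] := len2 x0 x1 y%:M.
  by rewrite x00 eqxx in x0N.
exists (p a), (p b); rewrite !iotaE.
by have /matrixP/(_ ord0 ord0) := yE; rewrite !hE !mul_scalar_mx !mxE eqxx.
Qed.

Lemma realizes_ext q (F : 'I_q -> falgType k) (r : 'I_q -> nat)
    (g g' : Lambda -> forall t, matalg (F t) (r t)) (ker ker' : Lambda -> Prop) :
    (forall a t, g' a t = g a t) -> (forall a, ker a <-> ker' a) ->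
  realizes g ker -> realizes g' ker'.
Proof.
move=> gg' kk' [A [th [f [elem_f gE th_surj th_ker]]]]; exists A, th, f.
by split=> // [a t|a]; rewrite ?gg' // -kk'.
Qed.

(** Both division algebras are quotients of [Lambda] by the same kernel. *)
Lemma transitive1_iso (F F' : falgType k) r r'
    (g : {lrmorphism Lambda -> matalg F r}) (g' : {lrmorphism Lambda -> matalg F' r'}) :
    division F -> r = 1%N -> r' = 1%N ->
    acts_transitively g -> acts_transitively g' -> (forall a, g a = 0 <-> g' a = 0) ->
  alg_isomorphic F F'.
Proof.
move=> divF r1 r1'; subst r r' => trg trg' kerE.
have [h hE] := matalg1_entry g; have [h' h'E] := matalg1_entry g'.
have [a|t tE] := @lrmorphism_factor _ _ _ _ h h' (transitive1_surj hE trg).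
  by have := kerE a; rewrite hE h'E !scalar_mx1_eq0 => -[].
exists t; apply: inj_surj_bij; first exact: division_rmorph_inj.
by move=> y; have [a <-] := transitive1_surj h'E trg' y; exists (h a).
Qed.
End Realization.

(* A column space on which [L] acts transitively is a copy of [L] through the *)
(* orbit map [u] of the first basis vector; transporting the right scalars    *)
(* and the standard basis back along [u] gives the extension and its basis.   *)
Lemma transitive_regular (k : fieldType) (K L : falgType k)
    (f : {lrmorphism L -> matalg K 2}) :
    division L -> acts_transitively f ->
  exists (iota : {lrmorphism K -> L}) (e : 'I_2 -> L),
    [/\ \dim {:L} = (2 * \dim {:K})%N, right_basis iota e
      & regular_embedding iota e f].
Proof.
move=> divL trf; pose d0 : 'cV[K]_2 := delta_mx ord0 ord0.
have d0N : d0 != 0.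
  by apply/eqP => /colP/(_ ord0)/eqP; rewrite !mxE !eqxx oner_eq0.
pose u (d : L) : 'cV[K]_2 := (f d : 'M_2) *m d0.
have uM d d' : u (d * d') = (f d : 'M_2) *m u d'.
  by rewrite /u rmorphM mulmxA.
have uD d d' : u (d + d') = u d + u d' by rewrite /u raddfD /= mulmxDl.
have u0 : u 0 = 0 by rewrite /u raddf0 mul0mx.
have u_sum (G : 'I_2 -> L) : u (\sum_s G s) = \sum_s u (G s).
  exact: (big_morph u uD u0).
(* A nonzero element killed by [u] would be invertible, and applying [f] of its inverse would give
   [d0 = 0]. *)
have u_inj : injective u.
  move=> x y xy; apply: subr0_eq; apply/eqP/negPn/negP => /divL Uxy.
  case/eqP: d0N; rewrite -[d0]mul1mx -[1%:M](rmorph1 f) -(mulVr Uxy).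
  rewrite -/(u _) uM; suff -> : u (x - y) = 0 by rewrite mulmx0.
  by apply: (addIr (u y)); rewrite -uD subrK xy add0r.
have /choice[v vK] : forall x, exists d, u d = x.
  by move=> x; have [a ->] := trf d0 x d0N; exists a.
have uZ (c : k) d : u (c *: d) = map_mx (fun x : K => c *: x) (u d).
  rewrite /u linearZ /=; apply/colP=> s; rewrite !mxE scaler_sumr.
  by apply: eq_bigr => t _; rewrite !mxE scalerAl.
have [||iota iotaE] := @lrmorphism_of k K L (fun c => v (d0 *m c%:M)).
- move=> c x y; apply: u_inj; rewrite uD uZ !vK.
  apply/colP=> s; rewrite !mxE !big_ord1 !mxE eqxx !mulr1n.
  by rewrite mulrDr scalerAr.
(* The left action through [f] commutes with right scalars, so [iota] preserves the order of
   products. *)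
- split=> [|x y]; apply: u_inj; first by rewrite vK mulmx1 /u rmorph1 mul1mx.
  by rewrite uM !vK scalar_mxM !mulmxA -[_ *m d0]/(u _) vK.
pose e s := v (delta_mx s ord0).
have u_basis (s : 'I_2) d : u (e s * iota d) = delta_mx s ord0 *m d%:M.
  by rewrite iotaE uM vK mulmxA -[_ *m d0]/(u _) vK.
have u_comb (c : 'cV[K]_2) : u (\sum_s e s * iota (c s ord0)) = c.
  rewrite u_sum; apply/colP=> t; rewrite summxE (bigD1 t) //= big1 => [|s st].
    by rewrite u_basis mxE big_ord1 !mxE !eqxx mul1r addr0.
  by rewrite u_basis mxE big_ord1 !mxE [t == s]eq_sym (negPf st) mul0r.
exists iota, e; split.
(* The two coordinates of the orbit vector identify [L] with [K * K] over [k]. *)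
- pose g d : (K * K)%type := (u d ord0 ord0, u d ord_max ord0).
  have lin_g : linear g by move=> c x y; rewrite /g uD uZ !mxE.
  rewrite mul2n -addnn -dim_prod; apply: (linear_bij_dim lin_g).
  apply: inj_surj_bij => [x y [xy0 xy1] | [a b]].
    apply: u_inj; apply/colP=> s; case: (unliftP ord0 s) => [s'|] -> //.
    by rewrite ord1; have -> : lift ord0 ord0 = ord_max :> 'I_2 by apply: val_inj.
  exists (v (\col_s if s == ord0 then a else b)).
  by rewrite /g vK !mxE.
- move=> x; exists (u x); split; first by apply: u_inj; rewrite u_comb.
  by move=> c ->; rewrite u_comb.
move=> a t; apply: u_inj.
rewrite uM vK -colE -[LHS](u_comb); congr u.
by apply: eq_bigr => s _; rewrite mxE.
Qed.

(** * Blocks whose target is a two-by-two matrix algebra *)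

Section RealizationMatrix.
Variables (k : fieldType) (Lambda : algType k).

Lemma realizes_regular (K L : falgType k) r
    (g : {lrmorphism Lambda -> matalg K r}) (p : {lrmorphism Lambda -> L}) :
    division K -> division L -> r = 2%N ->
    (forall d, exists a, p a = d) -> (forall a, p a = 0 <-> g a = 0) ->
    acts_transitively g ->
  @realizes _ _ 1 (fun=> K) (fun=> r) (fun a _ => g a) (fun a => g a = 0).
Proof.
move=> divK divL r2; subst r => p_surj ker_p trg.
have [f fE] := lrmorphism_factor p_surj (fun a => proj1 (ker_p a)).
have trf : acts_transitively f.
  by move=> x0 x1 /(trg x0 x1)[a ->]; exists (p a); rewrite fE.
have [iota [e [dimL e_basis f_reg]]] := transitive_regular divL trf.
exists L, p, (fun a _ => f a); split=> //.
exact: (Elem_regular divK divL dimL e_basis f_reg).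
Qed.

(** Since [y *m x = 1%:M], the matrix [x *m y] is an idempotent; it commutes with the action, hence
    the compression by [y] and [x] is multiplicative. *)
Lemma corner_morphism (F : falgType k) r (g : {lrmorphism Lambda -> matalg F r})
    (x : 'cV[F]_(r.-1.+1)) (y : 'rV[F]_(r.-1.+1)) :
    y *m x = 1%:M ->
    (forall a, (g a : 'M_(r.-1.+1)) *m (x *m y) = x *m y *m g a) ->
  exists h : {lrmorphism Lambda -> F},
    forall a, y *m (g a : 'M_(r.-1.+1)) *m x = (h a)%:M.
Proof.
move=> yx xy_central.
have [||h hE] := @lrmorphism_of k Lambda F
    (fun a => (y *m (g a : 'M_(r.-1.+1)) *m x) ord0 ord0).
- move=> c a b; rewrite linearP /= mulmxDr mulmxDl mxE; congr (_ + _).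
  rewrite !mxE scaler_sumr; apply: eq_bigr => s _.
  rewrite !mxE scalerAl; congr (_ * _); rewrite scaler_sumr.
  by apply: eq_bigr => t _; rewrite !mxE scalerAr.
- split=> [|a b]; first by rewrite rmorph1 mulmx1 yx mxE.
  rewrite rmorphM; transitivity
    (((y *m (g a : 'M_(r.-1.+1)) *m x) *m (y *m (g b : 'M_(r.-1.+1)) *m x)) ord0 ord0).
    rewrite !mulmxA -[_ *m x *m y]mulmxA -[y *m _ *m (x *m y)]mulmxA xy_central.
    by rewrite !mulmxA yx mul1mx.
  by rewrite mxE big_ord1.
by exists h => a; rewrite hE; exact: mx11_scalar.
Qed.

(** The columns [x0], [x1] and the rows [y0], [y1] form mutually inverse matrices, and conjugation
    by them diagonalizes the action. The last hypothesis makes the two diagonal entries independent,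
    so that the source is all of [F * F]. *)
Lemma realizes_diagonal (F : falgType k) r (g : {lrmorphism Lambda -> matalg F r})
    (x0 x1 : 'cV[F]_(r.-1.+1)) (y0 y1 : 'rV[F]_(r.-1.+1)) :
    division F -> (0 < r)%N -> y0 *m x0 = 1%:M -> y1 *m x1 = 1%:M ->
    y0 *m x1 = 0 -> y1 *m x0 = 0 ->
    x0 *m y0 + x1 *m y1 = 1%:M ->
    (forall a, (g a : 'M_(r.-1.+1)) *m (x0 *m y0) = x0 *m y0 *m g a) ->
    (forall a, (g a : 'M_(r.-1.+1)) *m (x1 *m y1) = x1 *m y1 *m g a) ->
    (forall c d, exists a, (g a : 'M_(r.-1.+1)) *m x0 = x0 *m c /\
                           (g a : 'M_(r.-1.+1)) *m x1 = x1 *m d) ->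
  exists P Q : matalg F r, [/\ P * Q = 1, Q * P = 1 &
    @realizes _ _ 1 (fun=> F) (fun=> r) (fun a _ => P * g a * Q) (fun a => g a = 0)].
Proof.
move=> divF r_gt0 yx00 yx11 yx01 yx10 xy1 central0 central1 surj.
have [h0 h0E] := corner_morphism yx00 central0.
have [h1 h1E] := corner_morphism yx11 central1.
pose X : 'M[F]_(r.-1.+1, 1 + 1) := row_mx x0 x1.
pose Y : 'M[F]_(1 + 1, r.-1.+1) := col_mx y0 y1.
have XY : X *m Y = 1%:M by rewrite mul_row_col.
have YX : Y *m X = 1%:M.
  by rewrite mul_col_row yx00 yx01 yx10 yx11 -scalar_mx_block.
have YgX a : Y *m (g a : 'M_(r.-1.+1)) *m X = block_mx (h0 a)%:M 0 0 (h1 a)%:M.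
  rewrite mul_col_mx mul_col_row h0E h1E; congr block_mx.
    (* Off the diagonal, [x0 *m y0] is inserted next to [y0] and moved across [g a], where it meets
       [x1] and vanishes. *)
    rewrite -[y0]mul1mx -yx00 -!mulmxA [x0 *m (y0 *m _)]mulmxA [x0 *m y0 *m _]mulmxA.
    by rewrite -central0 -!mulmxA yx01 !mulmx0.
  rewrite -[y1]mul1mx -yx11 -!mulmxA [x1 *m (y1 *m _)]mulmxA [x1 *m y1 *m _]mulmxA.
  by rewrite -central1 -!mulmxA yx10 !mulmx0.
(* [X] and [Y] are inverse to each other on both sides, so their two sizes agree. *)
have r2 : r = 2%N.
  have := mulmx1_leq XY; have := mulmx1_leq YX; rewrite prednK // => r_ge r_le.
  by apply/eqP; rewrite eqn_leq r_le r_ge.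
subst r; exists Y, X; split=> //.
have [||h hE] := @lrmorphism_of k Lambda (F * F)%type (fun a => (h0 a, h1 a)).
- by move=> c a b; rewrite !linearP.
- by split=> [|a b]; rewrite ?rmorph1 ?rmorphM.
exists (F * F)%type, h, (fun a _ => block_mx (a.1%:M : 'M_1) 0 0 (a.2%:M : 'M_1)).
split.
- exact: Elem_diagonal.
- by move=> a _; rewrite hE; exact: YgX.
- move=> [c d]; have [a [ga0 ga1]] := surj c%:M d%:M; exists a; rewrite hE.
  congr (_, _); apply: scalar_mx1_inj.
    by rewrite -h0E -mulmxA ga0 mulmxA yx00 mul1mx.
  by rewrite -h1E -mulmxA ga1 mulmxA yx11 mul1mx.
move=> a; rewrite hE; split=> [[h0a h1a]|ga].
  have : X *m (Y *m (g a : 'M_2) *m X) *m Y = 0.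
    by rewrite YgX h0a h1a !raddf0 block_mx_const mulmx0 mul0mx.
  by rewrite !mulmxA XY mul1mx -mulmxA XY mulmx1.
congr (_, _); apply/scalar_mx1_eq0.
  by rewrite -h0E ga mulmx0 mul0mx.
by rewrite -h1E ga mulmx0 mul0mx.
Qed.
End RealizationMatrix.

(** * Central idempotents and their components *)

Section NodalAnalysis.
Variables (k : fieldType) (m : nat).
Variables (F : 'I_m.+1 -> falgType k) (r : 'I_m.+1 -> nat).
Hypothesis divF : forall j, division (F j).
Variables (Lambda : algType k) (n : nat) (D : 'I_n.+1 -> falgType k).
Variable p : forall i, {lrmorphism Lambda -> D i}.
Hypothesis divD : forall i, division (D i).
Hypothesis p_inj : forall a, (forall i, p i a = 0) -> a = 0.
Hypothesis p_surj : forall d : (forall i, D i), exists a, forall i, p i a = d i.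
Variable phi : {lrmorphism Lambda -> prodalg (fun j => matalg (F j) (r j) : algType k)}.
Hypothesis nodal_phi : nodal_embedding phi.

Lemma proj_surj i (d : D i) : exists a, p i a = d.
Proof.
by have [a pa] := p_surj (dfwith (fun=> 0) d); exists a; rewrite pa dfwith_in.
Qed.

(** Joint surjectivity provides this element; joint injectivity reduces identities about it to
    checks on projections. *)
Definition idem i : Lambda := sval (cid (p_surj (dfwith (fun=> 0) (1 : D i)))).

Lemma proj_idem i : p i (idem i) = 1.
Proof. by rewrite /idem; case: cid => a /= ->; rewrite dfwith_in. Qed.

Lemma proj_idem0 i l : i != l -> p l (idem i) = 0.
Proof. by move=> il; rewrite /idem; case: cid => a /= ->; rewrite dfwith_out. Qed.

Lemma proj_eq a b : (forall i, p i a = p i b) -> a = b.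
Proof.
move=> ab; apply: subr0_eq; apply: p_inj => i.
by rewrite linearB /= ab subrr.
Qed.

Lemma idem_central i a : a * idem i = idem i * a.
Proof.
apply: proj_eq => l; rewrite !rmorphM /=; have [<-|il] := eqVneq i l.
  by rewrite proj_idem mulr1 mul1r.
by rewrite proj_idem0 // mulr0 mul0r.
Qed.

Lemma idemM i : idem i * idem i = idem i.
Proof.
apply: proj_eq => l; rewrite rmorphM /=; have [<-|il] := eqVneq i l.
  by rewrite proj_idem mulr1.
by rewrite proj_idem0 // mulr0.
Qed.

Lemma idem_orth i l : i != l -> idem i * idem l = 0.
Proof.
move=> il; apply: p_inj => s; rewrite rmorphM /=; have [<-|is'] := eqVneq i s.
  by rewrite proj_idem mul1r proj_idem0 // eq_sym.
by rewrite proj_idem0 // mul0r.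
Qed.

Lemma idem_sum : \sum_i idem i = 1.
Proof.
apply: proj_eq => l; rewrite rmorph1 linear_sum /= (bigD1 l) //= proj_idem.
by rewrite big1 ?addr0 // => i il; rewrite proj_idem0.
Qed.

Lemma idem_ker i a : p i a = 0 -> a * idem i = 0.
Proof.
move=> pa; apply: p_inj => l; rewrite rmorphM /=; have [<-|il] := eqVneq i l.
  by rewrite /= pa mul0r.
by rewrite proj_idem0 // mulr0.
Qed.

Local Notation N j := (r j).-1.+1.

Definition comp j : {lrmorphism Lambda -> matalg (F j) (r j)} :=
  prodalg_eval j \o phi.

Definition E i j : 'M[F j]_(N j) := comp j (idem i).

Definition supp i : {set 'I_m.+1} := [set j | E i j != 0].

Lemma suppP i j : reflect (E i j <> 0) (j \in supp i).
Proof. by rewrite inE; apply: (iffP idP) => /eqP. Qed.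

Lemma E_central i j a : (comp j a : 'M_(N j)) *m E i j = E i j *m comp j a.
Proof.
have := congr1 (comp j) (idem_central i a).
by rewrite !rmorphM.
Qed.

Lemma EM i j : E i j *m E i j = E i j.
Proof. by have := congr1 (comp j) (idemM i); rewrite rmorphM. Qed.

Lemma E_orth i l j : i != l -> E i j *m E l j = 0.
Proof.
by move=> il; have := congr1 (comp j) (idem_orth il); rewrite rmorphM raddf0.
Qed.

Lemma E_sum j : \sum_i E i j = 1%:M.
Proof. by have := congr1 (comp j) idem_sum; rewrite rmorph1 linear_sum. Qed.

Lemma E_ker i j a : p i a = 0 -> E i j = 1%:M -> comp j a = 0.
Proof.
move=> /idem_ker/(congr1 (comp j)); rewrite rmorphM raddf0 => /= aE E1.
by rewrite -[LHS]mulr1 -[RHS]aE; congr (_ * _); exact: esym E1.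
Qed.

Lemma E1_supp i l j : E i j = 1%:M -> i != l -> E l j = 0.
Proof. by move=> E1 /E_orth => /(_ j); rewrite E1 mul1mx. Qed.

Lemma supp_owner j : exists i, j \in supp i.
Proof.
apply: contrapT => no_i; have /eqP := E_sum j.
rewrite big1 => [|i _]; first by rewrite eq_sym (negPf (matrix_nonzero1 _ _)).
by apply/eqP/negPn/negP => Eij; case: no_i; exists i; rewrite inE.
Qed.

(** Injectivity of [phi] enters here: an idempotent meeting no factor would be killed. *)
Lemma supp_neq0 i : exists j, j \in supp i.
Proof.
apply: contrapT => no_j; have [phi_inj _] := nodal_phi.
have /eqP := oner_neq0 (D i); rewrite -(proj_idem i).
suff -> : idem i = 0 by rewrite linear0.
apply: phi_inj; rewrite raddf0; apply/ffunP=> j; rewrite [RHS]ffunE.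
by apply/eqP/negPn/negP => Eij; case: no_j; exists j; rewrite inE.
Qed.

(** * Nodality tested on triples of elements *)

Definition gamma := prodalg (fun j => matalg (F j) (r j) : algType k).

Lemma nodal3 i (w0 w1 w2 : gamma) :
    w0 * phi (idem i) = w0 -> w1 * phi (idem i) = w1 -> w2 * phi (idem i) = w2 ->
  [\/ w0 = 0, exists a, w1 = phi a * w0
    | exists a b, w2 = phi a * w0 + phi b * w1].
Proof.
move=> we0 we1 we2; pose w (s : 'I_3) := nth 0 [:: w0; w1; w2] s.
have we s : w s * phi (idem i) = w s by case: s => -[|[|[|//]]].
have := nodal_dependent nodal_phi (@divD i) (@proj_surj i) (proj_idem i)
  (@idem_ker i) we.
by rewrite /w !inordK.
Qed.

(** For a nonzero [y] fixed by [E i j], the map [x |-> mono x y] embeds the column space as a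
    [Lambda]-module into the left ideal generated by [phi (idem i)]. *)
Definition mono j (x : 'cV[F j]_(N j)) (y : 'rV[F j]_(N j)) : gamma :=
  prodalg_single (A := fun j => matalg (F j) (r j) : algType k) (x *m y).

Lemma mono_idem i j x y : y *m E i j = y -> mono x y * phi (idem i) = mono x y.
Proof.
move=> yE; rewrite /mono prodalg_single_mul; congr prodalg_single.
by rewrite -[RHS]/(x *m y) -{2}yE mulmxA.
Qed.

Lemma mono_act j a x y : phi a * @mono j x y = mono ((comp j a : 'M_(N j)) *m x) y.
Proof.
rewrite /mono prodalg_mul_single; congr prodalg_single.
by rewrite -mulmxA.
Qed.

Lemma mono_inj j x x' y : y != 0 -> @mono j x y = mono x' y -> x = x'.
Proof.
move=> /(division_row_inv (@divF j))[z yz] /prodalg_single_inj/(congr1 (mulmx^~ z)).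
by rewrite -!mulmxA yz !mulmx1.
Qed.

Lemma mono0 j y : @mono j 0 y = 0.
Proof. by rewrite /mono mul0mx prodalg_single0. Qed.

Lemma monoDl j x x' y : @mono j (x + x') y = mono x y + mono x' y.
Proof. by rewrite /mono mulmxDl prodalg_singleD. Qed.

Lemma E_row i j : j \in supp i -> exists2 y : 'rV_(N j), y != 0 & y *m E i j = y.
Proof.
rewrite inE => /mx_neq0_row[s ys]; exists (row s (E i j)) => //.
by rewrite -row_mul EM.
Qed.

Lemma E_col i j : j \in supp i -> exists2 x : 'cV[F j]_(N j), x != 0 & E i j *m x = x.
Proof.
rewrite inE => /mx_neq0_col[s xs]; exists (col s (E i j)) => //.
by rewrite !colE mulmxA EM.
Qed.

(** A nonzero row fixed by some [E i j] transports the triple to [mono] elements, where [nodal3]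
    applies. *)
Lemma comp_len2 j (x0 x1 x2 : 'cV[F j]_(N j)) :
  [\/ x0 = 0, exists a, x1 = comp j a *m x0
    | exists a b, x2 = comp j a *m x0 + comp j b *m x1].
Proof.
have [i ji] := supp_owner j; have [y y0 yE] := E_row ji.
have [] := nodal3 (mono_idem x0 yE) (mono_idem x1 yE) (mono_idem x2 yE).
- by rewrite -(mono0 y) => /(mono_inj y0); constructor 1.
- by move=> [a]; rewrite mono_act => /(mono_inj y0); constructor 2; exists a.
move=> [a [b]]; rewrite !mono_act -monoDl => /(mono_inj y0).
by constructor 3; exists a, b.
Qed.

Local Notation transitive j := (acts_transitively (comp j)).

(** [E i j] commutes with the action and fixes a nonzero column, hence fixes its whole orbit. *)
Lemma transitive_E i j : transitive j -> j \in supp i -> E i j = 1%:M.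
Proof.
move=> trj /E_col[x x0 Ex]; apply: mulmx_cV_inj => y.
have [a ->] := trj x y x0.
by rewrite mul1mx mulmxA -E_central -mulmxA Ex.
Qed.

(** If [i] also met [j'], then [E i j'], placed in the factor [j'], could not be generated by
    elements living in the factor [j]; so [x1] would always lie in the orbit of [x0]. *)
Lemma not_transitive_supp i j j' :
  ~ transitive j -> j \in supp i -> j' \in supp i -> j' = j.
Proof.
move=> ntr ji j'i; apply/eqP/negPn/negP => j'j; apply: ntr => x0 x1 x0N.
have [y y0 yE] := E_row ji.
pose A j := matalg (F j) (r j) : algType k.
pose w2 : gamma := prodalg_single (A := A) (E i j').
have w2E : w2 * phi (idem i) = w2.
  by rewrite /w2 prodalg_single_mul; congr prodalg_single; exact: EM.
have [] := nodal3 (mono_idem x0 yE) (mono_idem x1 yE) w2E.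
- by rewrite -(mono0 y) => /(mono_inj y0) x00; rewrite x00 eqxx in x0N.
- by move=> [a]; rewrite mono_act => /(mono_inj y0); exists a.
move=> [a [b]]; rewrite !mono_act -monoDl => /(congr1 (prodalg_eval j')).
rewrite /prodalg_eval prodalg_single_in prodalg_single_out 1?eq_sym // => Eij'.
by rewrite inE Eij' eqxx in j'i.
Qed.

(** Here the third element is [mono x0 y1]: being generated by elements with row [y0], it has row
    proportional to [y0] once [x0] is cancelled. *)
Lemma not_transitive_row i j y0 y1 :
    ~ transitive j -> y0 *m E i j = y0 -> y1 *m E i j = y1 -> y0 != 0 ->
  exists c : 'M_1, y1 = c *m y0.
Proof.
move=> ntr y0E y1E y0N; apply: contrapT => no_c; apply: ntr => x0 x1 x0N.
have [] := nodal3 (mono_idem x0 y0E) (mono_idem x1 y0E) (mono_idem x0 y1E).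
- by rewrite -(mono0 y0) => /(mono_inj y0N) x00; rewrite x00 eqxx in x0N.
- by move=> [a]; rewrite mono_act => /(mono_inj y0N); exists a.
move=> [a [b]]; rewrite !mono_act -monoDl => /prodalg_single_inj.
have [z zx] := division_col_inv (@divF j) x0N.
move=> /(congr1 (mulmx z)); rewrite !mulmxA zx mul1mx => y1c.
by case: no_c; eexists; exact: y1c.
Qed.

(** Nonzero columns fixed by three orthogonal idempotents commuting with the action cannot depend on
    one another. *)
Lemma supp_owners_le2 i l h j :
    j \in supp i -> j \in supp l ->
  j \in supp h -> i != l -> h != i -> h != l -> False.
Proof.
move=> /E_col[x0 x0N Ex0] /E_col[x1 x1N Ex1] /E_col[x2 x2N Ex2] il hi hl.
have [] := comp_len2 x0 x1 x2; first by move/eqP; rewrite (negPf x0N).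
  move=> [a x1E]; case/eqP: x1N; rewrite -Ex1 x1E -Ex0 [_ *m (E i j *m _)]mulmxA.
  by rewrite E_central !mulmxA E_orth 1?eq_sym // !mul0mx.
move=> [a [b x2E]]; case/eqP: x2N.
rewrite -Ex2 x2E -Ex0 -Ex1 [_ *m (E i j *m _)]mulmxA [_ *m (E l j *m _)]mulmxA.
by rewrite !E_central mulmxDr !mulmxA !E_orth // !mul0mx addr0.
Qed.

(** Right multiplication commutes with the action: [z1] separates [w1] from the orbit of [w0], so
    [w2] is generated by both, and [z2] kills it too. *)
Lemma nodal_sep i (w0 w1 w2 z1 z2 : gamma) :
    w0 * phi (idem i) = w0 -> w1 * phi (idem i) = w1 -> w2 * phi (idem i) = w2 ->
    w0 <> 0 -> w0 * z1 = 0 -> w1 * z1 <> 0 -> w0 * z2 = 0 -> w1 * z2 = 0 ->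
  w2 * z2 = 0.
Proof.
move=> w0E w1E w2E w0N w0z1 w1z1 w0z2 w1z2.
have [//||] := nodal3 w0E w1E w2E => [[a w1a] | [a [b ->]]].
  by case: w1z1; rewrite w1a -mulrA w0z1 mulr0.
by rewrite mulrDl -!mulrA w0z2 w1z2 !mulr0 addr0.
Qed.

(** The components of [phi (idem i)] at three factors are separated by the units of these
    factors. *)
Lemma supp_le2 i j j' j'' : j \in supp i -> j' \in supp i -> j'' \in supp i ->
  j != j' -> j'' != j -> j'' != j' -> False.
Proof.
pose A := fun j => matalg (F j) (r j) : algType k.
pose w j : gamma := prodalg_single (A := A) (E i j).
pose z j : gamma := prodalg_single (A := A) (1 : A j).
have wE s : w s * phi (idem i) = w s.
  by rewrite /w prodalg_single_mul; congr prodalg_single; exact: EM.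
have wz s t : s != t -> w s * z t = 0.
  move=> st; rewrite /z prodalg_mul_single prodalg_single_out //.
  by rewrite mul0r prodalg_single0.
have wN s : s \in supp i -> w s <> 0.
  move=> /suppP si /(congr1 (prodalg_eval s)); rewrite /prodalg_eval.
  by rewrite prodalg_single_in ffunE.
have wz1 s : w s * z s = w s.
  by rewrite /z prodalg_mul_single prodalg_single_in mulr1.
move=> ji j'i j''i jj' j''j j''j'.
apply: (wN _ j''i); rewrite -wz1.
apply: (nodal_sep (wE j) (wE j') (wE j'') (z1 := z j')).
- exact: wN.
- exact: wz.
- by rewrite wz1; apply: wN.
- by apply: wz; rewrite eq_sym.
by apply: wz; rewrite eq_sym.
Qed.

(** * Kernels, supports and ranks *)

Hypothesis rpos : forall j, (0 < r j)%N.
Hypothesis isoF : forall i j, alg_isomorphic (F i) (F j) -> F i = F j.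

(** If [p l a] is nonzero it is invertible, so [idem l] is a left multiple of [a * idem l], and
    [E l j] vanishes with [comp j a]. *)
Lemma comp_ker j a : comp j a = 0 <-> forall l, j \in supp l -> p l a = 0.
Proof.
split=> [fa l | pa].
  rewrite inE => Elj; apply/eqP/negPn/negP => /(@divD l) Ua.
  have [b pb] := proj_surj (p l a)^-1.
  case/eqP: Elj; rewrite -[RHS](mul0mx _ (E l j)) -(mulmx0 _ (comp j b : 'M_(N j))) -fa.
  have /(congr1 (comp j)) : idem l = b * a * idem l.
    apply: subr0_eq; rewrite -{1}[idem l]mul1r -mulrBl; apply: idem_ker.
    by rewrite linearB rmorph1 rmorphM /= pb mulVr // subrr.
  by rewrite !rmorphM.
rewrite -[a]mulr1 -idem_sum mulr_sumr linear_sum big1 // => l _.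
have [jl|] := boolP (j \in supp l); first by rewrite idem_ker ?raddf0 //; apply: pa.
rewrite inE negbK => /eqP Elj; rewrite rmorphM.
by transitivity ((comp j a : 'M_(N j)) *m E l j); rewrite // Elj mulmx0.
Qed.

(** Supports are equal or disjoint: a transitive factor meets one idempotent only, and a
    non-transitive one is the whole support of each idempotent meeting it. *)
Lemma supp_eq i l j : j \in supp i -> j \in supp l -> supp l = supp i.
Proof.
move=> ji jl; have [-> //|il] := eqVneq i l.
have [trj|ntr] := pselect (transitive j).
  by case/suppP: jl; apply: E1_supp il; apply: transitive_E.
suff supp1 h : j \in supp h -> supp h = [set j] by rewrite (supp1 _ ji) (supp1 _ jl).
move=> jh; apply/setP=> j'; rewrite in_set1; apply/idP/eqP => [|-> //].
exact: not_transitive_supp.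
Qed.

Lemma comp_ker_supp i j a :
  j \in supp i -> comp j a = 0 <-> forall l, supp l = supp i -> p l a = 0.
Proof.
move=> ji; rewrite comp_ker; split=> pa l.
  by move=> li; apply: pa; rewrite li.
by move=> /(supp_eq ji); apply: pa.
Qed.

Lemma proj_ker i j a : E i j = 1%:M -> p i a = 0 <-> comp j a = 0.
Proof.
move=> E1; split=> [pa | /comp_ker]; first exact: E_ker E1.
by apply; rewrite inE E1 matrix_nonzero1.
Qed.

(** Two distinct rows give two independent copies of the column space, which already exhaust length
    2. *)
Lemma transitive_two_rows i j (s0 s1 : 'I_(N j)) (w2 z2 : gamma) :
    transitive j -> j \in supp i -> s0 != s1 -> w2 * phi (idem i) = w2 ->
    (forall s, s \in [:: s0; s1] ->
       delta_mx ord0 s *m (z2 j : 'M_(N j)) = 0 :> 'rV_(N j)) ->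
  w2 * z2 = 0.
Proof.
move=> trj ji s01 w2E z2s.
pose A j := matalg (F j) (r j) : algType k.
have E1 := transitive_E trj ji.
pose x : 'cV[F j]_(N j) := delta_mx ord0 ord0.
have wE s : mono x (delta_mx ord0 s) * phi (idem i) = mono x (delta_mx ord0 s).
  by apply: mono_idem; rewrite E1 mulmx1.
have wN s : mono x (delta_mx ord0 s) <> 0.
  rewrite /mono mul_delta_mx => /(congr1 (prodalg_eval j)).
  rewrite /prodalg_eval prodalg_single_in ffunE => /matrixP/(_ ord0 s)/eqP.
  by rewrite !mxE !eqxx oner_eq0.
have monoM y (z : gamma) : mono x y * z = mono x (y *m (z j : 'M_(N j))).
  rewrite /mono prodalg_single_mul; congr prodalg_single.
  exact: esym (mulmxA _ _ _).
have mono_r0 : mono x 0 = 0 by rewrite /mono mulmx0 prodalg_single0.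
(* The matrix unit at [s1] kills the row [s0] and keeps the row [s1]. *)
apply: (nodal_sep (wE s0) (wE s1) w2E
  (z1 := prodalg_single (A := A) (delta_mx s1 s1))) => //.
- by rewrite monoM prodalg_single_in mul_delta_mx_0.
- by rewrite monoM prodalg_single_in mul_delta_mx; apply: wN.
- by rewrite monoM z2s ?mono_r0 // !inE eqxx.
by rewrite monoM z2s ?mono_r0 // !inE eqxx orbT.
Qed.

(** A third row would survive multiplication by its own matrix unit, which kills the first two. *)
Lemma transitive_rank i j : transitive j -> j \in supp i -> (r j <= 2)%N.
Proof.
move=> trj ji; rewrite leqNgt; apply/negP => r3.
have N3 : (2 < N j)%N by rewrite prednK.
pose s (t : nat) : 'I_(N j) := inord t.
pose A j := matalg (F j) (r j) : algType k.
pose x : 'cV[F j]_(N j) := delta_mx ord0 ord0.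
have s_val t : (t < 3)%N -> s t = t :> nat by move=> t3; rewrite inordK ?(leq_trans t3).
have /(congr1 (prodalg_eval j)) : mono x (delta_mx ord0 (s 2%N)) *
    (prodalg_single (A := A) (delta_mx (s 2%N) (s 2%N)) : gamma) = 0.
  apply: (@transitive_two_rows i j (s 0%N) (s 1%N)) => //.
  - by rewrite -val_eqE /= !s_val.
  - by apply: mono_idem; rewrite (transitive_E trj ji) mulmx1.
  move=> t ts; rewrite prodalg_single_in mul_delta_mx_0 //.
  by move: ts; rewrite !inE => /orP[] /eqP ->; rewrite -val_eqE /= !s_val.
rewrite /mono prodalg_single_mul /prodalg_eval !prodalg_single_in ffunE.
rewrite mul_delta_mx [_ * _]mul_delta_mx => /matrixP/(_ ord0 (s 2%N))/eqP.
by rewrite !mxE !eqxx oner_eq0.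
Qed.

(** The two rows in the factor [j] leave no room for a component at [j'], detected by the unit of
    that factor. *)
Lemma transitive_rank2_supp i j j' : transitive j -> j \in supp i -> r j = 2%N ->
  j' \in supp i -> j' = j.
Proof.
move=> trj ji r2 j'i; apply/eqP/negPn/negP => j'j.
pose A j := matalg (F j) (r j) : algType k.
pose w2 : gamma := prodalg_single (A := A) (E i j').
have s01 : inord 0 != inord 1 :> 'I_(N j).
  by rewrite -val_eqE /= !inordK // prednK // r2.
have : w2 * prodalg_single (A := A) (1 : A j') = 0.
  apply: (transitive_two_rows trj ji s01) => [|s _].
    by rewrite /w2 prodalg_single_mul; congr prodalg_single; exact: EM.
  by rewrite prodalg_single_out // mulmx0.
rewrite prodalg_single_mul prodalg_single_in mulr1 => /(congr1 (prodalg_eval j')).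
rewrite /prodalg_eval prodalg_single_in ffunE => Eij'.
by rewrite inE Eij' eqxx in j'i.
Qed.

Lemma not_transitive_rank1 i j :
  ~ transitive j -> E i j = 1%:M -> r j = 1%N.
Proof.
move=> ntr E1; apply/eqP; rewrite eqn_leq rpos andbT leqNgt; apply/negP => r2.
have N2 : (1 < N j)%N by rewrite prednK.
pose s t : 'I_(N j) := inord t.
have s01 : s 0%N != s 1%N by rewrite -val_eqE /= !inordK.
pose y t : 'rV[F j]_(N j) := delta_mx ord0 (s t).
have yE t : y t *m E i j = y t by rewrite E1 mulmx1.
have y0 : y 0%N != 0.
  by apply/eqP => /rowP/(_ (s 0%N))/eqP; rewrite !mxE !eqxx oner_eq0.
have [c /rowP/(_ (s 1%N))/eqP] := not_transitive_row ntr (yE 0%N) (yE 1%N) y0.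
by rewrite !mxE big_ord1 !mxE !eqxx [s 1%N == _]eq_sym (negPf s01) mulr0 oner_eq0.
Qed.

(** All rows of [E i j] are multiples of one fixed row [y]; cancelling [y] in [y *m E i j = y] gives
    [y *m x = 1%:M]. *)
Lemma not_transitive_factor i j : ~ transitive j -> j \in supp i ->
  exists (x : 'cV_(N j)) (y : 'rV_(N j)), E i j = x *m y /\ y *m x = 1%:M.
Proof.
move=> ntr ji; have [y y0 yE] := E_row ji.
have /choice[c cE] s : exists c : 'M_1, row s (E i j) = c *m y.
  by apply: (not_transitive_row ntr yE) => //; rewrite -row_mul EM.
have Exy : E i j = (\col_s c s ord0 ord0) *m y.
  apply/row_matrixP=> s; rewrite cE row_mul; congr (_ *m _).
  by apply/matrixP=> a b; rewrite !mxE !ord1.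
exists (\col_s c s ord0 ord0), y; split=> //.
have [z yz] := division_row_inv (@divF j) y0.
by rewrite -[LHS]mulmx1 -yz mulmxA -[y *m _ *m y]mulmxA -Exy yE.
Qed.

(** In the triple [x0], [x0 *m c], [x1], the last cannot be generated by the others, since [E l j]
    kills these and fixes [x1]. *)
Lemma comp_transitive_in i l j (x0 x1 : 'cV_(N j)) (y0 y1 : 'rV_(N j)) (c : 'M_1) :
    i != l -> E i j = x0 *m y0 -> E l j = x1 *m y1 ->
    y0 *m x0 = 1%:M -> y1 *m x1 = 1%:M ->
  exists a, (comp j a : 'M_(N j)) *m x0 = x0 *m c.
Proof.
move=> il E0 E1 yx0 yx1.
have neq0 (x : 'cV[F j]_(N j)) (y : 'rV_(N j)) : y *m x = 1%:M -> x <> 0.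
  move=> yx x0'; have /eqP := matrix_nonzero1 (F j) 0.
  by rewrite -yx x0' mulmx0.
have Ex0 : E l j *m x0 = 0.
  rewrite -[x0]mulmx1 -yx0 [x0 *m (y0 *m x0)]mulmxA -E0 mulmxA.
  by rewrite E_orth 1?eq_sym // mul0mx.
have Ex1 : E l j *m x1 = x1 by rewrite E1 -mulmxA yx1 mulmx1.
have [/(neq0 _ _ yx0) //|[a x0c]|[a [b x1E]]] := comp_len2 x0 (x0 *m c) x1.
  by exists a.
case: (neq0 _ _ yx1); rewrite -Ex1 x1E mulmxDr !mulmxA -!E_central.
by rewrite -!mulmxA [E l j *m (x0 *m c)]mulmxA Ex0 mul0mx !mulmx0 addr0.
Qed.

(* Factors [l] and [i] of [Lambda] lie in the same block exactly when they    *)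
(* meet the same factors of [Gamma], which [sigma] enumerates.                *)
Definition block_data i q (sigma : 'I_q -> 'I_m.+1) (P Q : gamma) :=
  [/\ P * Q = 1, Q * P = 1, injective sigma,
      forall j, j \in supp i <-> exists t, sigma t = j &
      realizes (fun a t => P (sigma t) * comp (sigma t) a * Q (sigma t))
               (fun a => forall l, supp l = supp i -> p l a = 0)].

Lemma block_data1 i q (sigma : 'I_q -> 'I_m.+1) : injective sigma ->
    (forall j, j \in supp i <-> exists t, sigma t = j) ->
    realizes (fun a t => comp (sigma t) a)
             (fun a => forall l, supp l = supp i -> p l a = 0) ->
  block_data i sigma 1 1.
Proof.
move=> sigma_inj sigma_supp real; split; rewrite ?mulr1 //.
apply: realizes_ext real => // a t.
by rewrite !ffunE mul1r mulr1.
Qed.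

Lemma block_single i j : j \in supp i -> (forall j', j' \in supp i -> j' = j) ->
  forall j', j' \in supp i <-> exists t : 'I_1, j = j'.
Proof.
by move=> ji supp1 j'; split=> [/supp1 -> | [_ <-] //]; exists ord0.
Qed.

Lemma block_exists i : exists q (sigma : 'I_q -> 'I_m.+1) P Q, block_data i sigma P Q.
Proof.
have [j ji] := supp_neq0 i; have ker_j := fun a => comp_ker_supp a ji.
have inj1 : injective (fun _ : 'I_1 => j) by move=> s t _; rewrite !ord1.
have [trj|ntr] := pselect (transitive j); last first.
  have supp1 j' : j' \in supp i -> j' = j by apply: not_transitive_supp.
  have sigma_supp := block_single ji supp1.
  have [E1|EN1] := eqVneq (E i j) 1%:M.
    exists 1%N, (fun=> j), 1, 1; apply: block_data1 => //.
    apply: realizes_ext (realizes_extension (@divD i) (@divF j)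
      (not_transitive_rank1 ntr E1) (@proj_surj i)
      (fun a => proj_ker a E1) ntr (@comp_len2 j)) => //.
  (* The idempotents sum to 1, so a second one is nonzero at [j]; this leads to type (4). *)
  have [l il jl] : exists2 l, i != l & j \in supp l.
    apply: contrapT => no_l; case/eqP: EN1; rewrite -(E_sum j) (bigD1 i) //=.
    rewrite big1 ?addr0 // => l li; apply/eqP/negPn/negP => jl.
    by case: no_l; exists l; rewrite ?inE // eq_sym.
  have [x0 [y0 [E0 yx0]]] := not_transitive_factor ntr ji.
  have [x1 [y1 [E1 yx1]]] := not_transitive_factor ntr jl.
  have yx01 : y0 *m x1 = 0.
    rewrite -[y0]mul1mx -yx0 -[_ *m y0]mulmxA -E0 -[x1]mulmx1 -yx1.
    rewrite [x1 *m _]mulmxA -E1 !mulmxA -[y0 *m _ *m _]mulmxA E_orth //.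
    by rewrite mulmx0 mul0mx.
  have yx10 : y1 *m x0 = 0.
    rewrite -[y1]mul1mx -yx1 -[_ *m y1]mulmxA -E1 -[x0]mulmx1 -yx0.
    rewrite [x0 *m _]mulmxA -E0 !mulmxA -[y1 *m _ *m _]mulmxA E_orth 1?eq_sym //.
    by rewrite mulmx0 mul0mx.
  have xy1 : x0 *m y0 + x1 *m y1 = 1%:M.
    rewrite -E0 -E1 -(E_sum j) (bigD1 i) //= (bigD1 l) 1?eq_sym //=.
    rewrite big1 ?addr0 // => h /andP[hi hl]; apply/eqP/negPn/negP => jh.
    by apply: (supp_owners_le2 ji jl _ il hi hl); rewrite inE.
  have surj c d : exists a, (comp j a : 'M_(N j)) *m x0 = x0 *m c /\
                            (comp j a : 'M_(N j)) *m x1 = x1 *m d.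
    (* [a] prescribes the action on [x0] and [b] that on [x1]; the idempotents combine them. *)
    have [a ax] := comp_transitive_in c il E0 E1 yx0 yx1.
    have [|b bx] := comp_transitive_in d _ E1 E0 yx1 yx0; first by rewrite eq_sym.
    have compE : comp j (a * idem i + b * idem l) =
        (comp j a : 'M_(N j)) *m E i j + (comp j b : 'M_(N j)) *m E l j.
      transitivity (comp j (a * idem i) + comp j (b * idem l)); first exact: raddfD.
      by congr (_ + _); exact: rmorphM.
    exists (a * idem i + b * idem l); rewrite compE !mulmxDl E0 E1.
    rewrite -!mulmxA yx0 yx1 yx01 yx10 !mulmx0 !mulmx1 ax bx.
    by rewrite addr0 add0r.
  have central0 a : (comp j a : 'M_(N j)) *m (x0 *m y0) = x0 *m y0 *m comp j a.
    by rewrite -E0 E_central.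
  have central1 a : (comp j a : 'M_(N j)) *m (x1 *m y1) = x1 *m y1 *m comp j a.
    by rewrite -E1 E_central.
  have [P0 [Q0 [PQ QP real]]] := realizes_diagonal (@divF j) (rpos j)
    yx0 yx1 yx01 yx10 xy1 central0 central1 surj.
  pose A j : algType k := matalg (F j) (r j).
  (* The conjugation is extended by [1] on the other factors. *)
  pose up (M : A j) : gamma := prodalg_of (A := A) (dfwith (fun=> 1) M).
  have upE M : up M j = M by rewrite ffunE dfwith_in.
  have upM M M' : M * M' = 1 -> up M * up M' = 1.
    move=> MM'; apply/ffunP=> j'; rewrite [RHS]ffunE !ffunE.
    by have [<-|jj'] := eqVneq j j'; rewrite ?dfwith_in // !dfwith_out // mulr1.
  exists 1%N, (fun=> j), (up P0), (up Q0); split; rewrite ?upM //.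
  by apply: realizes_ext real => [a t|//]; rewrite !upE.
have E1 := transitive_E trj ji.
have [r1|rN1] := eqVneq (r j) 1%N; last first.
  have r2 : r j = 2%N.
    by apply/eqP; rewrite eqn_leq (transitive_rank trj ji) ltn_neqAle eq_sym rN1 rpos.
  have supp1 j' : j' \in supp i -> j' = j by apply: transitive_rank2_supp.
  exists 1%N, (fun=> j), 1, 1; apply: block_data1 => //; first exact: block_single.
  exact: realizes_ext (realizes_regular (@divF j) (@divD i) r2 (@proj_surj i)
    (fun a => proj_ker a E1) trj).
have [[j' [j'i j'j]]|no_j'] :=
  pselect (exists j', j' \in supp i /\ j' != j); last first.
  have supp1 j' : j' \in supp i -> j' = j.
    by move=> j'i; apply/eqP/negPn/negP => j'j; apply: no_j'; exists j'.
  exists 1%N, (fun=> j), 1, 1; apply: block_data1 => //; first exact: block_single.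
  exact: realizes_ext (realizes_id (@divF j) r1 trj).
have trj' : transitive j'.
  apply: contrapT => ntr'; case/eqP: j'j.
  exact/esym/(not_transitive_supp ntr' j'i ji).
have r1' : r j' = 1%N.
  apply/eqP; rewrite eqn_leq rpos andbT -ltnS ltn_neqAle.
  rewrite (transitive_rank trj' j'i) andbT.
  apply: contra_neqN j'j => /eqP r2'; exact/esym/(transitive_rank2_supp trj' j'i).
have ker_j' := fun a => comp_ker_supp a j'i.
(* The common kernel gives an isomorphism, which [isoF] turns into an equality. *)
have Fj' : F j' = F j.
  apply/esym/isoF/(transitive1_iso (@divF j) r1 r1' trj trj') => a.
  by rewrite ker_j ker_j'.
pose sigma (t : 'I_2) := if t == ord0 then j else j'.
have sigmaP (P : 'I_m.+1 -> Prop) : P j -> P j' -> forall t, P (sigma t).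
  by move=> Pj Pj' t; rewrite /sigma; case: eqP.
exists 2%N, sigma, 1, 1; apply: block_data1.
- move=> s t; rewrite /sigma; case: eqP => [->|s0]; case: eqP => [->|t0] //.
  + by move=> jj'; rewrite jj' eqxx in j'j.
  + by move=> jj'; rewrite jj' eqxx in j'j.
  by move=> _; move/eqP/ord2_max: s0 => ->; move/eqP/ord2_max: t0 => ->.
- move=> h; split=> [hi | [t <-]]; last exact: (sigmaP (fun h => h \in supp i)).
  have [->|hj] := eqVneq h j; first by exists ord0.
  have [->|hj'] := eqVneq h j'; first by exists ord_max.
  by case: (supp_le2 ji j'i hi _ hj hj'); rewrite eq_sym.
apply: (realizes_twist (@divF j)).
- exact: (sigmaP (fun h => F h = F j)).
- exact: (sigmaP (fun h => r h = 1%N)).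
- exact: (sigmaP (fun h => transitive h)).
by apply: (sigmaP (fun h => forall a, comp h a = 0 <-> _)).
Qed.
End NodalAnalysis.

(** * Gluing the blocks *)

Lemma dependent_choice_prop (X : Type) (Y : X -> Type) (R : forall x, Y x -> Prop) :
  (forall x, exists y, R x y) -> exists f : forall x, Y x, forall x, R x (f x).
Proof.
by move=> ex; exists (fun x => sval (cid (ex x))) => x; case: cid.
Qed.

(** Blocks are the distinct values of [c], numbered by their position in a duplicate-free list; this
    list is nonempty, hence the form [.-1.+1]. *)
Lemma fiber_index (T : eqType) n (c : 'I_n.+1 -> T) :
  exists p (blk : 'I_n.+1 -> 'I_p.+1) (rep : 'I_p.+1 -> 'I_n.+1),
    cancel rep blk /\ forall i l, blk i = blk l <-> c i = c l.
Proof.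
pose s := undup (codom c).
have cs i : c i \in s by rewrite mem_undup codom_f.
have s_gt0 : (0 < size s)%N by have := cs ord0; case: (s).
have blk_lt i : (index (c i) s < (size s).-1.+1)%N by rewrite prednK // index_mem.
pose blk i : 'I_(size s).-1.+1 := inord (index (c i) s).
have blkE i : blk i = index (c i) s :> nat by rewrite inordK.
have /choice[rep repE] (b : 'I_(size s).-1.+1) : exists i, c i = nth (c ord0) s b.
  have : nth (c ord0) s b \in s by rewrite mem_nth // -[X in (_ < X)%N]prednK.
  by rewrite mem_undup => /codomP[i ->]; exists i.
exists (size s).-1, blk, rep; split=> [b | i l].
  apply: ord_inj; rewrite blkE repE index_uniq ?undup_uniq //.
  by rewrite -[X in (_ < X)%N]prednK.
split=> [/(congr1 (@nat_of_ord _))|il]; last by apply: ord_inj; rewrite !blkE il.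
by rewrite !blkE => /(congr1 (nth (c ord0) s)); rewrite !nth_index.
Qed.

Theorem theorem5p7 (k : fieldType) (m : nat)
    (F : 'I_m.+1 -> falgType k) (r : 'I_m.+1 -> nat)
    (rpos : forall j, (0 < r j)%N)
    (divF : forall j, division (F j))
    (isoF : forall i j, alg_isomorphic (F i) (F j) -> F i = F j)
    (Lambda : algType k) (basicL : basic Lambda)
    (phi : {lrmorphism Lambda ->
              prodalg (fun j => matalg (F j) (r j) : algType k)})
    (nodal_phi : nodal_embedding phi) :
  (exists psi : Lambda -> prodalg (fun j => matalg (F j) (r j) : algType k),
     similar_morphism phi psi /\ elementary_product psi) /\
  (forall (E : falgType k) (tau tau' : {lrmorphism E -> E}),
     division E -> bijective tau -> bijective tau' -> similar_morphism tau tau' ->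
     similar_morphism (fun a => (a, tau a)) (fun a => (a, tau' a))).
Proof.
split; last first.
  (* Conjugation by [(1, b)] leaves the first coordinate unchanged. *)
  move=> E tau tau' _ _ _ [b [b' [bb' b'b tauE]]].
  by exists (1, b), (1, b'); split=> [||a]; congr (_, _); rewrite /= ?mul1r ?mulr1.
have [n [D [p [divD p_inj p_surj]]]] := basic_projections basicL.
have [c [blk [rep [repK blkE]]]] := fiber_index (supp p_surj phi).
have supp_same := supp_eq divF divD p_inj nodal_phi.
have /choice[own ownP] := supp_owner p_inj p_surj phi.
have := fun b => block_exists divF divD p_inj p_surj nodal_phi rpos isoF (rep b).
move=> /dependent_choice_prop[q] /dependent_choice_prop[sigma].
move=> /dependent_choice_prop[P] /dependent_choice_prop[Q] data.
(* The realizations are isolated so that their witnesses can be chosen for all [b] at once. *)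
have real b := let: And5 _ _ _ _ h := data b in h.
move: real => /dependent_choice_prop[Ab] /dependent_choice_prop[th].
move=> /dependent_choice_prop[f] f_spec.
have sigma_supp b t : sigma b t \in supp p_surj phi (rep b).
  by case: (data b) => _ _ _ -> _; exists t.
have block_of b j : j \in supp p_surj phi (rep b) -> blk (own j) = b.
  by move=> jb; rewrite -[RHS]repK; apply/blkE/(supp_same _ _ _ _ jb (ownP j)).
have supp_rep i : supp p_surj phi (rep (blk i)) = supp p_surj phi i.
  by apply/blkE; rewrite repK.
(* At each factor the conjugating element of the block owning that factor is used. *)
pose P' : gamma F r := prodalg_of (fun j => P (blk (own j)) j).
pose Q' : gamma F r := prodalg_of (fun j => Q (blk (own j)) j).
exists (fun a => P' * phi a * Q'); split.
  exists P', Q'; split=> //; apply/ffunP=> j; rewrite [LHS]ffunE ![finfun _ _]ffunE.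
    have [PQ _ _ _ _] := data (blk (own j)).
    by have := congr1 (prodalg_eval j) PQ; rewrite /prodalg_eval !ffunE.
  have [_ QP _ _ _] := data (blk (own j)).
  by have := congr1 (prodalg_eval j) QP; rewrite /prodalg_eval !ffunE.
exists c, Ab, (prodalg_pair th), q, sigma, f; split.
- apply: inj_surj_bij => [|y].
    apply: raddf_inj => a tha; apply: p_inj => i.
    have [_ _ _ th_ker] := f_spec (blk i).
    have /th_ker : th (blk i) a = 0.
      by have := congr1 (prodalg_eval (blk i)) tha; rewrite /prodalg_eval !ffunE.
    by apply; rewrite supp_rep.
  have /choice[a aE] b : exists a, th b a = y b by have [_ _ th_surj _] := f_spec b.
  (* Each projection of [x] is copied from the preimage chosen for its own block. *)
  have [x xE] := p_surj (fun i => p i (a (blk i))).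
  exists x; apply/ffunP=> b; rewrite ffunE -aE; apply: subr0_eq; rewrite -linearB.
  have [_ _ _ th_ker] := f_spec b; apply/th_ker => l /blkE; rewrite repK => lb.
  by rewrite linearB /= xE lb subrr.
- apply: inj_surj_bij => [[b t] [b' t'] /= eq_sigma | j].
    (* Blocks have disjoint supports, so the common value determines the block. *)
    have bb' : b = b'.
      by rewrite -(block_of _ _ (sigma_supp b t)) eq_sigma; apply: block_of.
    subst b'; have [_ _ sigma_inj _ _] := data b.
    by rewrite (sigma_inj _ _ eq_sigma).
  have [_ _ _ sigma_surj _] := data (blk (own j)).
  have /sigma_surj[t tj] : j \in supp p_surj phi (rep (blk (own j))).
    by rewrite supp_rep.
  by exists (existT _ (blk (own j)) t).
- by move=> b; have [] := f_spec b.
move=> a b t; have [_ fE _ _] := f_spec b.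
have -> : prodalg_pair th a b = th b a by rewrite ffunE.
by rewrite -fE !ffunE (block_of _ _ (sigma_supp b t)).
Qed.
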